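(* Let $Q^+(7,2)$ be a non-degenerate hyperbolic quadric of ${\rm PG}(7,2)$ with fixed generator $\Pi$, and let $\mathcal G_3$ be the graph with vertex set $Q^+(7,2)\setminus\Pi$ where distinct vertices $P_1,P_2$ are adjacent iff either the line $\langle P_1,P_2\rangle$ is secant to $Q^+(7,2)$, or it is contained in $Q^+(7,2)$ and meets $\Pi$ in a point. Then $\mathcal G_3$ has exactly $12777$ maximal cliques, and every maximal clique is of one of the following five kinds: (1) (10752 cliques, size 5) the point set of an elliptic quadric $Q^-(3,2)=\sigma\cap Q^+(7,2)$, $\sigma$ a solid, not meeting $\Pi$; (2) (960 cliques, size 8) $\mathcal O\setminus\Pi$ for an ovoid $\mathcal O$ of $Q^+(7,2)$; (3) (15 cliques, size 8) $G\setminus\Pi$ for a generator $G$ of $Q^+(7,2)$ meeting $\Pi$ in a plane; (4) (840 cliques, size 8) $K\setminus\Pi$, where $K=\delta\cap Q^+(7,2)$ for a $4$-space $\delta$ is a cone $PQ^-(3,2)$ with vertex a point $P\in\Pi$ and base an elliptic quadric $Q^-(3,2)$, and $K$ meets $\Pi$ in a line; (5) (210 cliques, size 8) $K\setminus\Pi$, where $K=\gamma\cap Q^+(7,2)$ for a solid $\gamma$ is a cone $lQ^+(1,2)$ (union of two planes through a line $l$) with $l\subseteq\Pi$ and $K\cap\Pi=l$. In cases (1) and (2) all adjacencies are via secant lines, in case (3) all are via lines of the quadric meeting $\Pi$, and in cases (4) and (5) both kinds occur.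
   Context: A generator of $Q^+(7,2)$ is a solid contained in the quadric. An ovoid of $Q^+(7,2)$ is a set of points of the quadric meeting every generator in exactly one point. A maximal clique is a clique not properly contained in any other clique. *)

(* Defs.v *)
From mathcomp Require Import all_boot all_order all_algebra.

Set Implicit Arguments.
Unset Strict Implicit.
Unset Printing Implicit Defensive.

Import GRing.Theory.
Local Open Scope ring_scope.

(* The subspaces of PG(n-1,2) are the subspaces of 'rV['F_2]_n, of vector
   dimension one more than the projective one.  The only nonzero scalar of
   'F_2 is 1, so a point, i.e. a 1-dimensional subspace, is identified with
   its unique nonzero vector. *)
Definition points n (U : {vspace 'rV['F_2]_n}) : {set 'rV['F_2]_n} :=
  [set x | (x != 0) && (x \in U)].

Definition line n (x y : 'rV['F_2]_n) : {vspace 'rV['F_2]_n} :=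
  (<[x]> + <[y]>)%VS.

Definition polar n (Q : 'rV['F_2]_n -> 'F_2) (x y : 'rV['F_2]_n) : 'F_2 :=
  Q (x + y) - Q x - Q y.

Definition quadratic_form n (Q : 'rV['F_2]_n -> 'F_2) : Prop :=
  (forall a x, Q (a *: x) = a ^+ 2 * Q x) /\
  (forall y, scalar (fun x => polar Q x y)).

Definition quadric n (Q : 'rV['F_2]_n -> 'F_2) : {set 'rV['F_2]_n} :=
  [set x | (x != 0) && (Q x == 0)].

(* In characteristic 2 the singular points of a quadric are the points of the
   radical of the polar form that lie on the quadric. *)
Definition nondegenerate n (Q : 'rV['F_2]_n -> 'F_2)
    (U : {vspace 'rV['F_2]_n}) : Prop :=
  forall x, x \in U -> Q x = 0 -> (forall y, y \in U -> polar Q x y = 0) ->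
  x = 0.

Definition witt_index n (Q : 'rV['F_2]_n -> 'F_2)
    (U : {vspace 'rV['F_2]_n}) (m : nat) : Prop :=
  (exists W : {vspace 'rV['F_2]_n},
     [/\ (W <= U)%VS, points W \subset quadric Q & \dim W = m]) /\
  (forall W : {vspace 'rV['F_2]_n},
     (W <= U)%VS -> points W \subset quadric Q -> (\dim W <= m)%N).

(* The quadric induced on U is a Q^+(2m-1,2). *)
Definition hyperbolic n (Q : 'rV['F_2]_n -> 'F_2) (m : nat)
    (U : {vspace 'rV['F_2]_n}) : Prop :=
  [/\ \dim U = m.*2, nondegenerate Q U & witt_index Q U m].

(* The quadric induced on U is a Q^-(2m+1,2). *)
Definition elliptic n (Q : 'rV['F_2]_n -> 'F_2) (m : nat)
    (U : {vspace 'rV['F_2]_n}) : Prop :=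
  [/\ \dim U = m.+1.*2, nondegenerate Q U & witt_index Q U m].

Definition cone n (A : {vspace 'rV['F_2]_n}) (B : {set 'rV['F_2]_n}) :
    {set 'rV['F_2]_n} :=
  points A :|: \bigcup_(b in B) points (A + <[b]>)%VS.

(* The section of the quadric by D is a cone with vertex A over its section by
   a complement T of A in D. *)
Definition section_is_cone n (Q : 'rV['F_2]_n -> 'F_2)
    (D A T : {vspace 'rV['F_2]_n}) : Prop :=
  [/\ (A + T)%VS = D, (A :&: T)%VS = 0%VS
    & points D :&: quadric Q = cone A (points T :&: quadric Q)].

Definition generator (Q : 'rV['F_2]_8 -> 'F_2)
    (G : {vspace 'rV['F_2]_8}) : Prop :=
  \dim G = 4%N /\ points G \subset quadric Q.

Definition ovoid (Q : 'rV['F_2]_8 -> 'F_2) (O : {set 'rV['F_2]_8}) : Prop :=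
  O \subset quadric Q /\
  (forall G, generator Q G -> #|O :&: points G| = 1%N).

Definition is_clique (T : finType) (V : {set T}) (e : rel T) (C : {set T}) :
    bool :=
  (C \subset V) && [forall x in C, forall y in C, (x != y) ==> e x y].

Section GraphG3.

Context (Q : 'rV['F_2]_8 -> 'F_2) (Pi : {vspace 'rV['F_2]_8}).

Implicit Types (x y : 'rV['F_2]_8) (C : {set 'rV['F_2]_8}).

Definition G3_vertices : {set 'rV['F_2]_8} := quadric Q :\: points Pi.

Definition secant x y : bool := #|points (line x y) :&: quadric Q| == 2%N.

Definition line_on_quadric_meeting x y : bool :=
  (points (line x y) \subset quadric Q) && (\dim (line x y :&: Pi) == 1%N).

Definition G3_adj x y : bool :=
  (x != y) && (secant x y || line_on_quadric_meeting x y).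

Definition G3_maximal_clique C : bool :=
  maxset (is_clique G3_vertices G3_adj) C.

Definition kind1 C : Prop :=
  exists sigma : {vspace 'rV['F_2]_8},
    [/\ elliptic Q 1 sigma, C = points sigma :&: quadric Q
      & [disjoint C & points Pi]].

Definition kind2 C : Prop :=
  exists O : {set 'rV['F_2]_8}, ovoid Q O /\ C = O :\: points Pi.

Definition kind3 C : Prop :=
  exists G : {vspace 'rV['F_2]_8},
    [/\ generator Q G, \dim (G :&: Pi) = 3%N & C = points G :\: points Pi].

Definition kind4 C : Prop :=
  exists (delta tau l : {vspace 'rV['F_2]_8}) (P : 'rV['F_2]_8),
    let K := points delta :&: quadric Q in
    [/\ \dim delta = 5%N /\ P \in points Pi,
        elliptic Q 1 tau /\ section_is_cone Q delta <[P]>%VS tau,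
        \dim l = 2%N /\ K :&: points Pi = points l
      & C = K :\: points Pi].

Definition kind5 C : Prop :=
  exists gamma tau l : {vspace 'rV['F_2]_8},
    let K := points gamma :&: quadric Q in
    [/\ \dim gamma = 4%N /\ \dim l = 2%N,
        hyperbolic Q 1 tau /\ section_is_cone Q gamma l tau,
        (l <= Pi)%VS /\ K :&: points Pi = points l
      & C = K :\: points Pi].

Definition all_secant C : Prop :=
  {in C &, forall x y, x != y -> secant x y}.

Definition all_on_quadric C : Prop :=
  {in C &, forall x y, x != y -> line_on_quadric_meeting x y}.

Definition both_adjacencies C : Prop :=
  (exists x y, [/\ x \in C, y \in C, x != y & secant x y]) /\
  (exists x y, [/\ x \in C, y \in C, x != y & line_on_quadric_meeting x y]).

(* Exactly N maximal cliques are of the given kind; each of these has k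
   vertices and satisfies adjacencies. *)
Definition kind_spec (kind : {set 'rV['F_2]_8} -> Prop) (N k : nat)
    (adjacencies : {set 'rV['F_2]_8} -> Prop) : Prop :=
  (exists F : {set {set 'rV['F_2]_8}},
     (forall C, C \in F <-> G3_maximal_clique C /\ kind C) /\ #|F| = N) /\
  (forall C, G3_maximal_clique C -> kind C -> #|C| = k /\ adjacencies C).

End GraphG3.

(* Main.v *)
From mathcomp Require Import all_boot all_order all_algebra.
From mathcomp Require Import finfield.
Require Import Defs.

(* A basis of Pi dual to a totally singular family, adapted to a given vertex v,
   identifies the quadric with x.y = 0 on F_2^4 x F_2^4, Pi with y = 0 and v with
   (0, e_1); distinct vertices (x, y) and (x', y') are adjacent iff
   x.y' + x'.y = 1 or y = y'.  In these coordinates the 583 maximal cliques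
   through v are enumerated and matched with the five kinds by computation.  The
   kind of a maximal clique C is determined by its size k and by the common
   number m of points of C in the 4-space <Pi, P>, P in C: (k, m) is (5,1), (8,1),
   (8,8), (8,2), (8,4) for the kinds 1 to 5.  As there are 120 vertices v, and
   n = 448, 64, 1, 56, 14 cliques of each kind through every v, the number of
   cliques of each kind is 120 n / k. *)

(** The coordinates can be adapted to every vertex v, so one enumeration, at [code_base], serves all
    v and no transitive group of automorphisms has to be exhibited. To count the cliques of a kind,
    membership in the kind has to be equivalent to a value of (k, m), so each kind must also be
    excluded from the other values. For kinds 3, 4 and 5 general arguments on m do this. Kinds 1 and
    2 share m = 1, and an ovoid is given only by its intersections with generators, so here the
    computation supplies refutations too: a clique with (k, m) = (8, 1) spans more than a solid and
    is not of kind 1, and any other clique meets some explicit generator in a number of points that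
    an ovoid does not allow. In the positive direction no generators are enumerated: that nine
    points form an ovoid follows from a parity argument on nonperpendicular pairs. *)

Set Implicit Arguments.
Unset Strict Implicit.
Unset Printing Implicit Defensive.

(* Bron-Kerbosch enumeration of the maximal cliques that extend C by elements of
   P, where X holds the excluded elements adjacent to all of C; the number n only
   ensures termination. *)
Fixpoint cliques_from (T : Type) (e : rel T) n (C P X : seq T) : seq (seq T) :=
  if has (fun x => all (e x) P) X then [::] else
  if P isn't v :: P' then [:: C] else
  if n isn't n'.+1 then [::] else
  cliques_from e n' (v :: C) [seq w <- P' | e v w] [seq w <- X | e v w] ++
  cliques_from e n' C P' (v :: X).

(** * Correctness of the enumeration of maximal cliques *)

Section MaximalCliques.
Variables (T : finType) (e : rel T).
Hypothesis e_sym : symmetric e.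
Implicit Types (S : {set T}) (C P X : seq T).

Definition pairwise_adj S := [forall x in S, forall y in S, (x != y) ==> e x y].

Lemma pairwise_adjP S :
  reflect {in S &, forall x y, x != y -> e x y} (pairwise_adj S).
Proof.
apply: (iffP forall_inP) => [adj x y xS yS|adj x xS].
  by apply/implyP; apply: (forall_inP (adj x xS)).
by apply/forall_inP=> y yS; apply/implyP; apply: adj.
Qed.

(** The specification of a node of the search. Maximality is tested against P and X only: the
    vertices outside C, P and X have been dropped as nonadjacent to some element of C. *)
Definition extends C P X S : bool :=
  [&& [set x in C] \subset S, S \subset [set x in C ++ P], pairwise_adj S
    & [forall x, (x \in P ++ X) ==> (x \notin S) ==> [exists y in S, ~~ e x y]]].

Lemma extendsP C P X S :
  reflect [/\ {subset C <= S}, {subset S <= C ++ P}, pairwise_adj S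
    & forall x, x \in P ++ X -> x \notin S -> exists2 y, y \in S & ~~ e x y]
  (extends C P X S).
Proof.
apply: (iffP and4P) => -[CS SP adj max]; split=> //.
- by move=> x xC; apply: (subsetP CS); rewrite inE.
- by move=> x xS; have := subsetP SP x xS; rewrite inE.
- move=> x xPX xS; apply/exists_inP.
  by have /forallP/(_ x)/implyP/(_ xPX)/implyP/(_ xS) := max.
- by apply/subsetP=> x; rewrite inE => /CS.
- by apply/subsetP=> x /SP; rewrite inE.
- by apply/forallP=> x; apply/implyP=> xPX; apply/implyP=> xS; apply/exists_inP/max.
Qed.

(** If v is in S, a vertex nonadjacent to v is not in S and v itself shows that it cannot be added,
    so it may be dropped. If v is not in S, moving v to X keeps the condition that S cannot be
    enlarged by v. *)
Lemma extends_cons C v P X S : v \notin C -> v \notin P -> v \notin X ->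
  extends C (v :: P) X S =
  if v \in S then extends (v :: C) [seq w <- P | e v w] [seq w <- X | e v w] S
  else extends C P (v :: X) S.
Proof.
move=> vC vP vX; case: ifP => vS; apply/extendsP/extendsP => -[CS SP adj max];
  have adjP := pairwise_adjP _ adj; split=> //.
- by move=> x; rewrite inE => /orP[/eqP->|/CS].
- move=> x xS; have := SP x xS; rewrite !(mem_cat, inE) mem_filter.
  have [//|neq_xv] := eqVneq x v; case/or3P => [->//|//|->].
  by rewrite adjP ?orbT // eq_sym.
- move=> x; rewrite mem_cat !mem_filter -andb_orr => /andP[_ xPX].
  by apply: max; rewrite mem_cat inE -orbA xPX orbT.
- by move=> x xC; apply: CS; rewrite inE xC orbT.
- move=> x /SP; rewrite !(mem_cat, inE) mem_filter.
  by case/orP=> [/orP[->|->]|/andP[_ ->]]; rewrite ?orbT.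
- move=> x; rewrite mem_cat inE -orbA => /orP[/eqP->|xPX xS]; first by rewrite vS.
  case: (boolP (e v x)) => evx; last by exists v; rewrite // e_sym.
  by apply: max => //; rewrite mem_cat !mem_filter evx.
- move=> x xS; have := SP x xS; rewrite !(mem_cat, inE).
  by case: eqP xS => [->|//]; rewrite vS.
- move=> x xPX; apply: max; move: xPX; rewrite !(mem_cat, inE).
  by case/or3P=> ->; rewrite ?orbT.
- by move=> x /SP; rewrite !(mem_cat, inE) => /orP[->|->]; rewrite ?orbT.
- move=> x xPX; apply: max; move: xPX; rewrite !(mem_cat, inE).
  by case/orP=> [/orP[]|] ->; rewrite ?orbT.
Qed.

(** Counting occurrences instead of stating membership also shows that no clique is listed twice, on
    which the numbers of cliques rely. *)
Lemma count_cliques_from n C P X S :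
  (size P <= n)%N -> uniq (C ++ P ++ X) -> pairwise_adj [set x in C] ->
  {in C & P ++ X, forall c x, e c x} ->
  count_mem S [seq [set x in D] | D <- cliques_from e n C P X] = extends C P X S.
Proof.
(* Pruning loses nothing: an excluded vertex adjacent to all of P is adjacent to all of any
   candidate S, which is therefore not maximal. *)
have excluded C0 P0 X0 : uniq (C0 ++ P0 ++ X0) ->
    {in C0 & P0 ++ X0, forall c x, e c x} ->
    has (fun x => all (e x) P0) X0 -> ~~ extends C0 P0 X0 S.
  move=> unq adjC /hasP[x xX /allP adjx]; apply/extendsP=> -[_ SP _ max].
  have [||y yS /negP[]] := max x.
  - by rewrite mem_cat xX orbT.
  - apply/negP=> /SP; move: unq; rewrite catA cat_uniq => /and3P[_ /hasPn/(_ x xX)].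
    by move=> /negPf/=->.
  have := SP y yS; rewrite mem_cat => /orP[yC|/adjx //].
  by rewrite e_sym adjC // mem_cat xX orbT.
have leaf C0 : pairwise_adj [set x in C0] ->
    extends C0 [::] [::] S = (S == [set x in C0]).
  move=> adjC0; apply/extendsP/eqP => [[CS SC _ _]|->].
    apply/setP=> x; rewrite inE; apply/idP/idP => [/SC|/CS//].
    by rewrite cats0.
  by split=> // x; rewrite ?cats0 inE.
elim: n C P X => [|n IHn] C P X leP unq adj adjC.
  case: P leP unq adjC => // _ unq adjC /=.
  case: X unq adjC => [|x X] unq adjC /=; first by rewrite addn0 eq_sym leaf.
  by rewrite (negPf (excluded _ _ _ unq adjC _)).
rewrite /=; case: ifP => [/(excluded _ _ _ unq adjC)/negPf-> //|].
case: P leP unq adjC => [|v P] leP unq adjC.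
  case: X unq adjC => // _ _ _ /=; by rewrite addn0 eq_sym leaf.
move=> _; have [vC vP vX] : [/\ v \notin C, v \notin P & v \notin X].
  move: unq; rewrite -cat_rcons cat_uniq rcons_uniq => /and3P[/andP[vC _]].
  move=> nhas _; split=> //; apply: contra nhas => h; apply/hasP; exists v.
  - by rewrite mem_cat h.
  - by rewrite mem_rcons inE eqxx.
  - by rewrite mem_cat h orbT.
  - by rewrite mem_rcons inE eqxx.
have unq1 : uniq ((v :: C) ++ P ++ X).
  by rewrite -[(v :: C) ++ _]/([:: v] ++ C ++ (P ++ X)) uniq_catCA.
have unq2 : uniq (C ++ P ++ v :: X).
  rewrite -[v :: X]/([:: v] ++ X) catA uniq_catCA -catA.
  exact: unq1.
have sz : (size [seq w <- P | e v w] <= n)%N.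
  by rewrite size_filter (leq_trans (count_size _ _)).
have adjv : {in C, forall c, e v c}.
  by move=> c cC; rewrite e_sym adjC // inE eqxx.
rewrite map_cat count_cat extends_cons // IHn // ?IHn //.
(* Each branch already forces its side of the test on v, so the conditional is the sum of the two
   counts. *)
- have -> : extends (v :: C) [seq w <- P | e v w] [seq w <- X | e v w] S =
    (v \in S) && extends (v :: C) [seq w <- P | e v w] [seq w <- X | e v w] S.
    by apply/esym/andb_idl=> /extendsP[CS _ _ _]; apply: CS; rewrite inE eqxx.
  have -> : extends C P (v :: X) S = (v \notin S) && extends C P (v :: X) S.
    apply/esym/andb_idl; apply: contraTN => vS; apply/extendsP=> -[_ SP _ _].
    by have := SP v vS; rewrite mem_cat (negPf vC) (negPf vP).
  by case: (v \in S); rewrite /= ?addn0.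
- by move=> c x cC xPX; apply: adjC => //; move: xPX; rewrite !(mem_cat, inE) orbCA -orbA.
- by apply: subseq_uniq unq1; rewrite !cat_subseq ?filter_subseq ?subseq_refl.
- apply/pairwise_adjP=> x y; rewrite !inE => /orP[/eqP->|xC] /orP[/eqP->|yC].
  + by rewrite eqxx.
  + by rewrite adjv.
  + by rewrite e_sym adjv.
  + by apply: (pairwise_adjP _ adj); rewrite inE.
- move=> c x; rewrite inE mem_cat !mem_filter -andb_orr.
  case/orP=> [/eqP->|cC] /andP[evx xPX] //.
  by apply: adjC => //; rewrite inE mem_cat xPX orbT.
Qed.

(** A vertex of V outside l is nonadjacent to v, so it cannot enlarge a clique through v: maximality
    within l is maximality in V. *)
Lemma extends_vertex (V : {set T}) (l : seq T) v S :
  v \in V -> (forall w, (w \in l) = (w \in V) && e v w) ->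
  extends [:: v] l [::] S = maxset (is_clique V e) S && (v \in S).
Proof.
move=> vV lE; apply/extendsP/andP => [[vS SP adjS max]|[/maxsetP[/andP[SV adjS] max] vS]].
  have {}vS : v \in S by apply: vS; rewrite inE.
  split=> //; apply/maxsetP; split.
    apply/andP; split=> //; apply/subsetP=> x /SP.
    by rewrite mem_cat inE lE => /orP[/eqP->|/andP[]].
  move=> S' /andP[S'V /pairwise_adjP adjS'] SS'; apply/eqP; rewrite eqEsubset SS' andbT.
  apply/subsetP=> x xS'; apply/negPn/negP => xS.
  have neq_vx : v != x by apply: contraNneq xS => <-.
  have [|//|y yS /negP[]] := max x.
    by rewrite cats0 lE (subsetP S'V) //= adjS' // (subsetP SS').
  apply: adjS'; rewrite ?(subsetP SS' y) //.
  by apply: contraNneq xS => ->.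
have adjP := pairwise_adjP _ adjS.
split=> //.
- by move=> x; rewrite inE => /eqP->.
- move=> x xS; rewrite mem_cat inE lE (subsetP SV) //=.
  by have [//|neq_xv] := eqVneq x v; rewrite adjP // eq_sym.
- move=> x; rewrite cats0 lE => /andP[xV _] xS.
  apply/exists_inP/contraT => /exists_inPn adjx.
  case/negP: xS; rewrite -(max (x |: S)) ?setU11 ?subsetUr //.
  apply/andP; split; first by rewrite subUset sub1set xV.
  apply/pairwise_adjP=> y z; rewrite !in_setU1 => /orP[/eqP->|yS] /orP[/eqP->|zS].
  + by rewrite eqxx.
  + by move=> _; apply/negPn/adjx.
  + by move=> _; rewrite e_sym; apply/negPn/adjx.
  + exact: adjP.
Qed.

End MaximalCliques.

Import GRing.Theory.
Local Open Scope ring_scope.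

(** * Quadratic forms over F_2 *)

Lemma F2_cases (a : 'F_2) : a = 0 \/ a = 1.
Proof. by case: a => [[|[|m]]] // lt_m; [left | right]; apply: val_inj. Qed.

Lemma natr_addb (a b : bool) : (a (+) b)%:R = a%:R + b%:R :> 'F_2.
Proof. by case: a; case: b; apply: val_inj. Qed.

Lemma natr_andb (a b : bool) : (a && b)%:R = a%:R * b%:R :> 'F_2.
Proof. by case: a; case: b; apply: val_inj. Qed.

Lemma natrb_eq0 (a : bool) : (a%:R == 0 :> 'F_2) = ~~ a.
Proof. by case: a. Qed.

Section Vectors.
Variable n : nat.
Implicit Types (x y z : 'rV['F_2]_n) (U W : {vspace 'rV['F_2]_n}).

Lemma addvv x : x + x = 0.
Proof.
by apply/rowP=> i; rewrite !mxE; case: (F2_cases (x 0 i)) => ->; apply: val_inj.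
Qed.

Lemma oppv x : - x = x.
Proof. by apply/eqP; rewrite eq_sym -subr_eq0 opprK addvv. Qed.

Lemma addvvK x y : x + y + y = x.
Proof. by rewrite -addrA addvv addr0. Qed.

Lemma addv_eq0 x y : (x + y == 0) = (x == y).
Proof. by rewrite -[RHS]subr_eq0 oppv. Qed.

Lemma addv_eql x y : (x == x + y) = (y == 0).
Proof. by rewrite -[in LHS]addv_eq0 addrA addvv add0r. Qed.

Lemma addv_eqr x y : (y == x + y) = (x == 0).
Proof. by rewrite addrC addv_eql. Qed.

Lemma mem_vline x z : (z \in <[x]>%VS) = (z == 0) || (z == x).
Proof.
apply/vlineP/orP => [[a ->]|[/eqP->|/eqP->]].
- by case: (F2_cases a) => ->; rewrite ?scale0r ?scale1r eqxx; [left | right].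
- by exists 0; rewrite scale0r.
- by exists 1; rewrite scale1r.
Qed.

Lemma mem_addv_line U x z : (z \in <[x]> + U)%VS = (z \in U) || (x + z \in U).
Proof.
apply/memv_addP/orP => [[a]|].
  rewrite mem_vline => /orP[]/eqP-> [u uU ->]; rewrite ?add0r; first by left.
  by right; rewrite addrA addvv add0r.
case=> zU.
  by exists 0; [apply: mem0v | exists z; rewrite ?add0r].
exists x; first exact: memv_line.
by exists (x + z) => //; rewrite addrA addvv add0r.
Qed.

Lemma mem_line x y z : (z \in line x y) = [|| z == 0, z == x, z == y | z == x + y].
Proof.
rewrite /line mem_addv_line !mem_vline -(inj_eq (addrI x) (x + z)) addrA addvv.
rewrite add0r -(inj_eq (addrI x) (x + z) y) !addrA addvv add0r addr0.
by case: (z == 0); case: (z == x); case: (z == y); case: (z == x + y).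
Qed.

Lemma memv_addr_eq U x y : x + y \in U -> (x \in U) = (y \in U).
Proof.
move=> xyU; apply/idP/idP => h; last by rewrite -(addvvK x y) rpredD.
by rewrite -(addvvK y x) (addrC y) rpredD.
Qed.

Lemma card_memv U (S : {set 'rV['F_2]_n}) :
  (forall z, (z \in U) = (z \in S)) -> #|S| = (2 ^ \dim U)%N.
Proof.
move=> US; rewrite -[X in (X ^ _)%N](card_Fp (isT : prime 2)) -card_vspace.
by apply/esym/eq_card.
Qed.

Section Form.
Variable Q : 'rV['F_2]_n -> 'F_2.
Hypothesis Q_quadratic : quadratic_form Q.
Local Notation B := (polar Q).

Lemma polarC x y : B x y = B y x.
Proof. by rewrite /polar (addrC y x) -!addrA (addrC (- Q x)). Qed.

Lemma polarDl y : {morph (fun x => B x y) : u v / u + v}.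
Proof.
by move=> u v; have := Q_quadratic.2 y 1 u v; rewrite scale1r mul1r.
Qed.

Lemma polarDr x : {morph B x : u v / u + v}.
Proof. by move=> u v; rewrite polarC polarDl !(polarC x). Qed.

Lemma polar0l y : B 0 y = 0.
Proof. by apply: (addIr (B 0 y)); rewrite -polarDl !add0r. Qed.

Lemma polar0r x : B x 0 = 0.
Proof. by rewrite polarC polar0l. Qed.

Lemma polarZl a x y : B (a *: x) y = a * B x y.
Proof. by have := Q_quadratic.2 y a x 0; rewrite !addr0 polar0l addr0. Qed.

Lemma polarZr a x y : B x (a *: y) = a * B x y.
Proof. by rewrite polarC polarZl polarC. Qed.

Lemma polar_suml (I : Type) r (F : I -> 'rV['F_2]_n) y :
  B (\sum_(i <- r) F i) y = \sum_(i <- r) B (F i) y.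
Proof. by apply: (big_morph (fun x => B x y)) => [u v|]; rewrite ?polarDl ?polar0l. Qed.

Lemma polar_sumr (I : Type) r (F : I -> 'rV['F_2]_n) x :
  B x (\sum_(i <- r) F i) = \sum_(i <- r) B x (F i).
Proof. by apply: big_morph => [u v|]; rewrite ?polarDr ?polar0r. Qed.

Lemma quadr0 : Q 0 = 0.
Proof. by have := Q_quadratic.1 0 0; rewrite scale0r expr2 !mul0r. Qed.

Lemma quadrD x y : Q (x + y) = Q x + Q y + B x y.
Proof. by rewrite /polar -(addrA (Q (x + y))) -opprD [RHS]addrC subrK. Qed.

Lemma polarxx x : B x x = 0.
Proof.
rewrite /polar addvv quadr0 sub0r; case: (F2_cases (Q x)) => ->; exact: val_inj.
Qed.

Lemma in_quadric x : (x \in quadric Q) = (x != 0) && (Q x == 0).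
Proof. by rewrite inE. Qed.

Lemma polar_neq x y : B x y != 0 -> x != y.
Proof. by apply: contraNneq => ->; rewrite polarxx. Qed.

Lemma quadric_add x y : x \in quadric Q -> y \in quadric Q ->
  x != y -> (x + y \in quadric Q) = (B x y == 0).
Proof.
rewrite !in_quadric => /andP[_ /eqP Qx] /andP[_ /eqP Qy] neq_xy.
by rewrite addv_eq0 neq_xy quadrD Qx Qy !add0r.
Qed.

Lemma points_quadricP U :
  reflect (forall z, z \in U -> Q z = 0) (points U \subset quadric Q).
Proof.
apply: (iffP subsetP) => [UQ z zU|UQ z].
  have [->|z0] := eqVneq z 0; first exact: quadr0.
  by have := UQ z; rewrite !inE z0 zU => /(_ isT) /eqP.
by rewrite !inE => /andP[-> /UQ ->] /=.
Qed.

Definition pairwise_secant (S : {set 'rV['F_2]_n}) :=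
  {in S &, forall x y, x != y -> B x y != 0}.

(** Two perpendicular points of the quadric span a line on it, so index at most 1 means that no two
    points of the section are perpendicular. This turns the Witt index into a condition on a list of
    points. *)
Lemma witt_index1P U :
  witt_index Q U 1 <->
  (exists a, a \in points U :&: quadric Q) /\ pairwise_secant (points U :&: quadric Q).
Proof.
split=> [[[W [WU WQ dimW]] Umax]|[[a]]].
  split.
    have W0 : vpick W != 0 by rewrite vpick0 -dimv_eq0 dimW.
    exists (vpick W); rewrite in_setI (subsetP WQ) inE W0 ?memv_pick //.
    by rewrite (subvP WU) ?memv_pick.
  move=> a b; rewrite !in_setI => /andP[aU aQ] /andP[bU bQ] neq_ab; apply/negP=> ab0.
  have [[a0 {}aU] [b0 {}bU]] : (a != 0 /\ a \in U) /\ (b != 0 /\ b \in U).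
    by move: aU bU; rewrite !inE => /andP[-> ->] /andP[-> ->].
  have ab := quadric_add aQ bQ neq_ab; rewrite ab0 in ab.
  have lineU : (line a b <= U)%VS by rewrite subv_add -!memvE aU bU.
  have lineQ : points (line a b) \subset quadric Q.
    apply/subsetP=> z; rewrite inE mem_line => /andP[/negPf->] /=.
    by case/or3P=> /eqP->.
  have leD : (\dim (line a b) <= \dim <[a]>)%N.
    by rewrite dim_vline a0 (Umax _ lineU lineQ).
  have : (<[a]> == line a b)%VS by rewrite eqEdim addvSl leD.
  move/eqP=> eqL; have : b \in <[a]>%VS by rewrite eqL mem_line eqxx !orbT.
  by rewrite mem_vline (negPf b0) eq_sym (negPf neq_ab).
rewrite in_setI => /andP[aU aQ] secU.
have [a0 {}aU] : a != 0 /\ a \in U by move: aU; rewrite !inE => /andP[].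
split; last first.
  move=> W WU /subsetP WQ; have [->|W0] := eqVneq W 0%VS; first by rewrite dimv0.
  set w := vpick W; have w0 : w != 0 by rewrite vpick0.
  have wW : w \in W by apply: memv_pick.
  rewrite (leq_trans (n := \dim <[w]>%VS)) //; last by rewrite dim_vline leq_b1.
  apply/dimvS/subvP=> z zW; rewrite mem_vline.
  have [//|z0 /=] := eqVneq z 0; apply/negbNE/negP=> neq_zw.
  have [zQ wQ] : z \in quadric Q /\ w \in quadric Q.
    by split; apply: WQ; rewrite inE ?z0 ?w0.
  have := secU z w; rewrite !in_setI zQ wQ ![_ \in points _]inE z0 w0 !(subvP WU) //.
  move/(_ isT isT neq_zw)/negP; apply; rewrite -quadric_add //; apply: WQ.
  by rewrite inE addv_eq0 neq_zw rpredD.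
exists <[a]>%VS; rewrite -memvE aU dim_vline a0; split=> //.
by apply/subsetP=> z; rewrite inE mem_vline => /andP[/negPf->] /eqP->.
Qed.

(** A singular point of the radical would be perpendicular to every point of the section, hence
    equal to each of them, but there are at least two. *)
Lemma secant_nondegenerate U a b :
  pairwise_secant (points U :&: quadric Q) ->
  a \in points U :&: quadric Q -> b \in points U :&: quadric Q -> a != b ->
  nondegenerate Q U.
Proof.
move=> secU aU bU neq_ab x xU Qx xperp; apply/eqP/negPn/negP => x0.
have xUQ : x \in points U :&: quadric Q by rewrite !inE x0 xU Qx eqxx.
have perp c : c \in points U :&: quadric Q -> x = c.
  move=> cU; apply/eqP/negPn/negP=> neq_xc.
  have := secU _ _ xUQ cU neq_xc; rewrite xperp ?eqxx //.
  by move: cU; rewrite !inE => /andP[/andP[]].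
by move: neq_ab; rewrite -(perp a) // -(perp b) // eqxx.
Qed.

(** Q (a + t) = Q t when a is singular and perpendicular to t, so the section is determined by its
    base. *)
Lemma section_is_cone_intro D A T :
  (A + T)%VS = D -> (A :&: T)%VS = 0%VS ->
  {in A, forall a, Q a = 0} -> {in A & T, forall a t, B a t = 0} ->
  section_is_cone Q D A T.
Proof.
move=> defD AT0 QA BAT; split=> //; apply/setP=> z; rewrite !inE.
apply/idP/idP.
  case/andP=> [/andP[z0 zD]] /andP[_ /eqP Qz].
  move: zD; rewrite -defD => /memv_addP[a aA [t tT defz]].
  have [t0|t0] := eqVneq t 0.
    by rewrite z0 defz t0 addr0 aA.
  apply/orP; right; apply/bigcupP; exists t.
    rewrite !inE t0 tT /=; apply/eqP; move: Qz.
    by rewrite defz quadrD QA // BAT // add0r addr0.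
  by rewrite inE z0 defz memv_add ?memv_line.
case/orP=> [/andP[z0 zA]|/bigcupP[t]].
  by rewrite z0 QA // eqxx -defD (subvP (addvSl A T)).
rewrite !inE => /andP[/andP[t0 tT] /andP[_ /eqP Qt]] /andP[z0].
case/memv_addP=> a aA [u]; rewrite mem_vline => uE defz.
have [uT Qu] : u \in T /\ Q u = 0.
  by case/orP: uE => /eqP->; rewrite ?mem0v ?quadr0.
by rewrite z0 defz -defD memv_add // quadrD QA // Qu BAT // !addr0 eqxx.
Qed.

End Form.
End Vectors.

(** * Adjacency in G3 *)

Section Graph.
Variables (Q : 'rV['F_2]_8 -> 'F_2) (Pi : {vspace 'rV['F_2]_8}).
Hypothesis Q_quadratic : quadratic_form Q.
Hypothesis Pi_singular : points Pi \subset quadric Q.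
Local Notation B := (polar Q).
Local Notation V := 'rV['F_2]_8.
Implicit Types (x y z : V) (C : {set V}).

Lemma Pi_quadr0 x : x \in Pi -> Q x = 0.
Proof. exact: (points_quadricP Q_quadratic Pi Pi_singular). Qed.

Lemma in_vertices x : (x \in G3_vertices Q Pi) = (x \notin Pi) && (Q x == 0).
Proof.
by rewrite !inE; have [->|] := eqVneq x 0; rewrite ?mem0v.
Qed.

Lemma vertex_quadric x : x \in G3_vertices Q Pi -> x \in quadric Q.
Proof. by case/setDP. Qed.

(** A line over F_2 has only the third point x + y, and Q (x + y) = B x y for singular x and y. *)
Lemma secant_polar x y : x \in quadric Q -> y \in quadric Q ->
  x != y -> secant Q x y = (B x y != 0).
Proof.
move=> Qx Qy neq_xy.
have [[x0 _] [y0 _]] : (x != 0 /\ Q x == 0) /\ (y != 0 /\ Q y == 0).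
  by move: Qx Qy; rewrite !in_quadric => /andP[-> ->] /andP[-> ->].
have -> : secant Q x y = (x + y \notin quadric Q); last by rewrite quadric_add.
have neq_sum : x + y \notin [set x; y].
  by rewrite !inE ![x + y == _]eq_sym addv_eql addv_eqr (negPf x0) (negPf y0).
rewrite /secant.
have -> : points (line x y) :&: quadric Q =
    [set z in [set x; y] :|: [set x + y] | z \in quadric Q].
  apply/setP=> z; rewrite !inE mem_line.
  by case: (z =P 0) => [->|] //=; rewrite ?eqxx ?andbF //= orbA.
case: (boolP (x + y \in quadric Q)) => xyQ /=.
  rewrite (_ : [set _ in _ | _] = (x + y) |: [set x; y]).
    by rewrite cardsU1 neq_sum cards2 neq_xy.
  apply/setP=> z; rewrite inE setUC in_setU1; apply: andb_idr.
  by rewrite !in_setU1 in_set1 => /or3P[]/eqP->.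
rewrite (_ : [set _ in _ | _] = [set x; y]) ?cards2 ?neq_xy //.
apply/setP=> z; rewrite inE (setUC [set x; y]) (in_setU1 z (x + y)).
case: (z =P x + y) => [->|_] /=; first by rewrite (negPf xyQ) (negPf neq_sum).
by apply: andb_idr; rewrite in_setU1 in_set1 => /orP[]/eqP->.
Qed.

(** With x and y off Pi, the line can meet Pi only in x + y. If it does, this third point is
    singular like all of Pi, and the line is on the quadric. *)
Lemma line_on_quadric_Pi x y :
  x \in G3_vertices Q Pi -> y \in G3_vertices Q Pi -> x != y ->
  line_on_quadric_meeting Q Pi x y = (x + y \in Pi).
Proof.
move=> Vx Vy neq_xy; have [Qx Qy] := (vertex_quadric Vx, vertex_quadric Vy).
have [xPi yPi] : x \notin Pi /\ y \notin Pi.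
  by move: Vx Vy; rewrite !in_vertices => /andP[-> _] /andP[-> _].
have x0 : x != 0 by apply: contraNneq xPi => ->; rewrite mem0v.
have y0 : y != 0 by apply: contraNneq yPi => ->; rewrite mem0v.
rewrite /line_on_quadric_meeting; have [xyPi|xyPi] := boolP (x + y \in Pi).
  have -> : (line x y :&: Pi = <[x + y]>)%VS.
    apply/vspaceP=> z; rewrite memv_cap mem_line mem_vline.
    have [->|z0] := eqVneq z 0; first by rewrite mem0v.
    have [->|zx] := eqVneq z x; first by rewrite (negPf xPi) addv_eql (negPf y0).
    have [->|zy] := eqVneq z y; first by rewrite (negPf yPi) addv_eqr (negPf x0).
    by have [->|] := eqVneq z (x + y); rewrite ?xyPi.
  rewrite dim_vline addv_eq0 neq_xy andbT; apply/subsetP=> z.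
  rewrite inE mem_line => /andP[z0]; rewrite (negPf z0) /= => /or3P[]/eqP-> //.
  by rewrite in_quadric addv_eq0 neq_xy Pi_quadr0 //=.
apply/negbTE; rewrite negb_and orbC; apply/orP; left.
suff -> : (line x y :&: Pi = 0)%VS by rewrite dimv0.
apply/vspaceP=> z; rewrite memv_cap mem_line memv0.
have [->|z0 /=] := eqVneq z 0; first by rewrite mem0v.
apply/negbTE; rewrite negb_and -implybE; apply/implyP=> /or3P[]/eqP-> //.
Qed.

(** This makes the two sorts of adjacency mutually exclusive. *)
Lemma polar_Pi x y :
  x \in G3_vertices Q Pi -> y \in G3_vertices Q Pi -> x + y \in Pi -> B x y = 0.
Proof.
rewrite !in_vertices => /andP[_ /eqP Qx] /andP[_ /eqP Qy] /Pi_quadr0.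
by rewrite quadrD Qx Qy !add0r.
Qed.

Lemma G3_adj_polar x y : x \in G3_vertices Q Pi -> y \in G3_vertices Q Pi ->
  G3_adj Q Pi x y = (x != y) && ((B x y != 0) || (x + y \in Pi)).
Proof.
move=> Vx Vy; rewrite /G3_adj; have [//|neq_xy /=] := eqVneq x y.
by rewrite secant_polar ?vertex_quadric // line_on_quadric_Pi.
Qed.

(** For a clique C these are the points of C in the span of Pi and x, because the points of that
    span off Pi form the coset x + Pi. *)
Definition Pi_class C x : {set V} := [set y in C | x + y \in Pi].

Definition class_type (k m : nat) C : bool :=
  (#|C| == k) && [forall x in C, #|Pi_class C x| == m].

Lemma clique_vertex C x : is_clique (G3_vertices Q Pi) (G3_adj Q Pi) C ->
  x \in C -> x \in G3_vertices Q Pi.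
Proof. by case/andP=> /subsetP CV _; apply: CV. Qed.

Lemma clique_adj C x y : is_clique (G3_vertices Q Pi) (G3_adj Q Pi) C ->
  x \in C -> y \in C -> x != y -> (B x y != 0) || (x + y \in Pi).
Proof.
move=> clC xC yC neq_xy; have [Vx Vy] := (clique_vertex clC xC, clique_vertex clC yC).
case/andP: clC => _ /forallP/(_ x); rewrite xC => /forallP/(_ y).
by rewrite yC neq_xy G3_adj_polar // neq_xy.
Qed.

Lemma Pi_class_self C x : x \in C -> x \in Pi_class C x.
Proof. by move=> xC; rewrite inE xC addvv mem0v. Qed.

Lemma clique_adjacencies C x y (clC : is_clique (G3_vertices Q Pi) (G3_adj Q Pi) C) :
  x \in C -> y \in C -> x != y ->
  secant Q x y = (y \notin Pi_class C x) /\
  line_on_quadric_meeting Q Pi x y = (y \in Pi_class C x).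
Proof.
move=> xC yC neq_xy; have [Vx Vy] := (clique_vertex clC xC, clique_vertex clC yC).
rewrite secant_polar ?vertex_quadric // line_on_quadric_Pi // inE yC.
split=> //=; have := clique_adj clC xC yC neq_xy.
have [xyPi _|_ /=] := boolP (x + y \in Pi); first by rewrite polar_Pi ?eqxx.
by rewrite orbF => ->.
Qed.

Lemma class_type1_secant k C : is_clique (G3_vertices Q Pi) (G3_adj Q Pi) C ->
  class_type k 1 C -> all_secant Q C.
Proof.
move=> clC /andP[_ /forallP type1] x y xC yC neq_xy.
rewrite (clique_adjacencies clC _ _ neq_xy).1 //.
have /cards1P[z defz] := implyP (type1 x) xC.
have := Pi_class_self xC; rewrite defz !inE => /eqP<-.
by rewrite eq_sym.
Qed.

Lemma class_type_full k C : is_clique (G3_vertices Q Pi) (G3_adj Q Pi) C ->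
  class_type k k C -> all_on_quadric Q Pi C.
Proof.
move=> clC /andP[/eqP cardC /forallP typek] x y xC yC neq_xy.
rewrite (clique_adjacencies clC _ _ neq_xy).2 //.
have /eqP := implyP (typek x) xC; rewrite -cardC => eqc.
suff -> : Pi_class C x = C by [].
apply/eqP; rewrite eqEcard eqc leqnn andbT.
by apply/subsetP=> z; rewrite inE => /andP[].
Qed.

Lemma class_type_both k m C x : is_clique (G3_vertices Q Pi) (G3_adj Q Pi) C ->
  class_type k m C -> x \in C -> (1 < m < k)%N -> both_adjacencies Q Pi C.
Proof.
move=> clC /andP[/eqP cardC /forallP typem] xC /andP[m1 mk].
have /eqP cardm := implyP (typem x) xC.
have subC : Pi_class C x \subset C by apply/subsetP=> z; rewrite inE => /andP[].
have xx := Pi_class_self xC.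
split.
  have /subsetPn[y yC yx] : ~~ (C \subset Pi_class C x).
    by apply/negP=> /subset_leq_card; rewrite cardm cardC leqNgt mk.
  have neq_xy : x != y by apply: contraNneq yx => <-.
  by exists x, y; rewrite (clique_adjacencies clC _ _ neq_xy).1.
have /set0Pn[y] : Pi_class C x :\ x != set0.
  by rewrite -card_gt0; move: m1; rewrite -cardm (cardsD1 x) xx.
rewrite in_setD1 eq_sym => /andP[neq_xy yx].
have yC := subsetP subC y yx.
by exists x, y; rewrite (clique_adjacencies clC _ _ neq_xy).2.
Qed.

(** Points in one coset of Pi are perpendicular, whereas a section of Witt index 1 has no two
    perpendicular points. *)
Lemma kind1_class C x : kind1 Q Pi C -> x \in C -> Pi_class C x = [set x].
Proof.
case=> sigma [[_ _ wittU] defC disC] xC.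
have [_ sec] := (witt_index1P Q sigma).1 wittU; rewrite -defC in sec.
apply/setP=> y; rewrite in_set1; have [->|neq_yx] := eqVneq y x.
  by rewrite Pi_class_self.
apply/negP; rewrite inE => /andP[yC xyPi].
have CV z : z \in C -> z \in G3_vertices Q Pi.
  move=> zC; rewrite inE; have := disjointFr disC zC => ->.
  by move: zC; rewrite defC inE => /andP[].
have := sec _ _ yC xC neq_yx.
by rewrite polar_Pi ?eqxx ?CV // addrC.
Qed.

(** Points of a generator are perpendicular, so adjacency within it can only come from a line
    meeting Pi. *)
Lemma kind3_class C x : kind3 Q Pi C -> G3_maximal_clique Q Pi C -> x \in C ->
  Pi_class C x = C.
Proof.
case=> G [[_ GQ] _ defC] /maxsetP[clC _] xC.
apply/setP=> y; rewrite inE; apply: andb_idr => yC.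
have [<-|neq_xy] := eqVneq x y; first by rewrite addvv mem0v.
have QG := points_quadricP Q_quadratic G GQ.
have GP z : z \in C -> z \in G by rewrite defC !inE => /andP[_ /andP[]].
have := clique_adj clC xC yC neq_xy.
suff -> : B x y = 0 by rewrite eqxx.
by rewrite /polar !QG ?subr0 ?rpredD ?GP.
Qed.

(** Each ruling subspace of the cone contains the vertex A, so translation by A preserves it; as A
    lies in Pi, it also preserves being off Pi. *)
Lemma cone_translate D A T x a :
  section_is_cone Q D A T -> (A <= Pi)%VS ->
  x \in (points D :&: quadric Q) :\: points Pi -> a \in A ->
  x + a \in (points D :&: quadric Q) :\: points Pi.
Proof.
case=> _ _ -> API /setDP[xK xPi] aA.
have {}xPi : x \notin Pi.
  by apply: contra xPi => xPi; case/setUP: xK => [|/bigcupP[b _]];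
     rewrite !inE => /andP[-> _].
have aPi : a \in Pi by apply: subvP aA.
have xaPi : x + a \notin Pi by rewrite (@memv_addr_eq _ _ _ x) // addrC addrA addvv add0r.
rewrite in_setD inE negb_and xaPi orbT /=; case/setUP: xK => [|/bigcupP[b bT]].
  by rewrite inE => /andP[_ /(subvP API)]; rewrite (negPf xPi).
rewrite inE => /andP[_ xAb]; apply/setUP; right; apply/bigcupP; exists b => //.
rewrite inE rpredD ?(subvP (addvSl A _) a) // andbT.
by apply: contraNneq xaPi => ->; rewrite mem0v.
Qed.

(** The class of x is {x, x + P}. Any other point y of C lies over a different base point, and B x y
    is the value of B at the two base points, which is nonzero, while points of one coset of Pi are
    perpendicular. *)
Lemma kind4_class C x : kind4 Q Pi C -> x \in C -> #|Pi_class C x| = 2%N.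
Proof.
case=> delta [tau [l [P]]] [[_]].
rewrite inE => /andP[P0 PPi] [[_ _ wittT] coneD] _ defC xC.
have [_ secT] := (witt_index1P Q tau).1 wittT.
have CV z : z \in C -> z \in G3_vertices Q Pi.
  by rewrite defC => /setDP[/setIP[_ zQ] zPi]; apply/setDP.
have CPi z : z \in C -> z \notin Pi by move/CV; rewrite in_vertices => /andP[].
case: (coneD) => defD PT0 defK.
have Ptau : P \notin tau.
  apply: contra P0 => Pt; rewrite -memv0 -PT0 memv_cap memv_line //.
have PQ b : b \in points tau :&: quadric Q -> B P b = 0.
  move=> bT; have neq_Pb : P != b.
    by apply: contraNneq Ptau => ->; move: bT; rewrite !inE => /andP[/andP[]].
  have : P + b \in points delta :&: quadric Q.
    rewrite defK; apply/setUP; right; apply/bigcupP; exists b => //.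
    by rewrite inE addv_eq0 neq_Pb memv_add ?memv_line.
  case/setIP=> _ PbQ; apply/eqP; rewrite -quadric_add //.
    by rewrite in_quadric P0 Pi_quadr0 /=.
  by case/setIP: bT.
have decomp z : z \in C ->
    exists2 b, b \in points tau :&: quadric Q & z = b \/ z = b + P.
  move=> zC; have zPi := CPi z zC; have [z0 zP] : z != 0 /\ z != P.
    by split; apply: contraNneq zPi => ->; rewrite ?mem0v.
  move: zC; rewrite defC defK in_setD => /andP[_] /setUP[|/bigcupP[b bT]].
    by rewrite inE mem_vline (negPf z0) (negPf zP).
  rewrite inE -/(line P b) mem_line (negPf z0) (negPf zP) /= => zE.
  by exists b => //; case/orP: zE => /eqP->; [left | right; rewrite addrC].
suff -> : Pi_class C x = [set x; x + P] by rewrite cards2 addv_eql P0.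
apply/setP=> y; rewrite in_set2; apply/idP/idP; last first.
  case/orP=> /eqP->; first exact: Pi_class_self.
  by rewrite inE addrA addvv add0r PPi andbT defC (cone_translate coneD) -?defC ?memv_line.
(* Contraposition against [B x y == B x y]: one side is 0 because x + y is in Pi, and the other will
   be shown to be nonzero. *)
rewrite inE => /andP[yC xyPi]; apply: contraLR (eqxx (B x y)).
rewrite negb_or {2}polar_Pi ?CV // => /andP[yx yxP].
have [b bT xE] := decomp x xC; have [c cT yE] := decomp y yC.
have neq_bc : b != c.
  apply/negP=> /eqP bc; rewrite bc in xE.
  case: xE yE yx yxP => [-> [->|->]|-> [->|->]]; rewrite ?addvvK ?eqxx //.
suff -> : B x y = B b c by apply: secT.
have Pb : B b P = 0 by rewrite polarC PQ.
by case: xE yE => [-> [->|->]|-> [->|->]];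
  rewrite ?(polarDl Q_quadratic, polarDr Q_quadratic) ?Pb ?(PQ c) ?polarxx ?addr0.
Qed.

(** The four translates of x by l stay in C. The bound leaves the type (8, 8) possible, which
    [kind5_secant] excludes. *)
Lemma kind5_class C x : kind5 Q Pi C -> x \in C -> (4 <= #|Pi_class C x|)%N.
Proof.
case=> gamma [tau [l]] [[_ diml] [_ coneD] [lPi _] defC] xC.
have cardl : #|[set x + a | a in [set a | a \in l]]| = 4%N.
  rewrite card_imset; last exact: addrI.
  by rewrite (@card_memv _ l) ?diml // => z; rewrite inE.
apply: (leq_trans (eq_leq (esym cardl))); apply/subset_leq_card/subsetP=> y.
case/imsetP=> a; rewrite inE => al ->.
rewrite inE addrA addvv add0r (subvP lPi) // andbT defC.
by rewrite (cone_translate coneD) -?defC.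
Qed.

Lemma kind5_secant C : kind5 Q Pi C ->
  exists x y, [/\ x \in C, y \in C & B x y != 0].
Proof.
case=> gamma [tau [l]] [_ [[_ ndT wittT] coneD] [lPi KPi] defC].
have [[a aT] _] := (witt_index1P Q tau).1 wittT.
have [_ lT0 _] := coneD.
(* The base avoids Pi: a common point would lie in l, which meets [tau] trivially. *)
have tauC z : z \in points tau :&: quadric Q -> z \in C.
  case/setIP; rewrite inE => /andP[z0 zT] zQ.
  have zK : z \in points gamma :&: quadric Q.
    by rewrite in_setI zQ inE z0 -(let: And3 e _ _ := coneD in e) (subvP (addvSr l tau)).
  rewrite defC in_setD zK andbT; apply: contra z0 => zPi.
  have : z \in points l by rewrite -KPi in_setI zK.
  by rewrite inE => /andP[_ zl]; rewrite -memv0 -lT0 memv_cap zl.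
have [[a0 aT'] Qa] : (a != 0 /\ a \in tau) /\ Q a = 0.
  by move: aT; rewrite !inE => /andP[/andP[-> ->] /andP[_ /eqP]].
have [y /andP[yT ay]] : exists y, (y \in tau) && (B a y != 0).
  apply/existsP/contraT => /existsPn all0; case/eqP: a0.
  apply: ndT => // y yT; apply/eqP.
  by have := all0 y; rewrite yT negbK.
have ay1 : B a y = 1 by case: (F2_cases (B a y)) ay => ->.
(* Completion to a hyperbolic pair: Q b = Q y + Q y * B y a = 0, since B y a = 1. *)
pose b := y + Q y *: a; have ab : B a b = 1.
  by rewrite /b polarDr // polarZr // polarxx // mulr0 addr0.
exists a, b; split; rewrite ?tauC ?ab //.
rewrite !inE (_ : b != 0); last by apply/negP=> /eqP b0; move: ab; rewrite b0 polar0r.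
rewrite rpredD ?rpredZ //= /b quadrD Q_quadratic.1 Qa mulr0 addr0 polarZr //.
by rewrite polarC ay1 mulr1; case: (F2_cases (Q y)) => ->.
Qed.

End Graph.

(** * Coordinates *)

(* The code (x, y) stands for the vector sum_i x_i e_i + sum_i y_i f_i, where e is
   a basis of Pi and f a totally singular family dual to it. *)
Definition half : finType := (bool * bool * bool * bool)%type.
Definition code : finType := (half * half)%type.

Definition half0 : half := (false, false, false, false).
Definition code0 : code := (half0, half0).

Definition half_add (a b : half) : half :=
  let: (a1, a2, a3, a4) := a in let: (b1, b2, b3, b4) := b in
  (a1 (+) b1, a2 (+) b2, a3 (+) b3, a4 (+) b4).

Definition half_dot (a b : half) : bool :=
  let: (a1, a2, a3, a4) := a in let: (b1, b2, b3, b4) := b in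
  a1 && b1 (+) a2 && b2 (+) a3 && b3 (+) a4 && b4.

Definition code_add (s t : code) : code := (half_add s.1 t.1, half_add s.2 t.2).

Definition code_form (t : code) : bool := half_dot t.1 t.2.

Definition code_polar (s t : code) : bool :=
  half_dot s.1 t.2 (+) half_dot s.2 t.1.

Definition code_pi (t : code) : bool := t.2 == half0.

Definition code_base : code := (half0, (true, false, false, false)).

Lemma half_add_eq0 a b : (half_add a b == half0) = (a == b).
Proof. by move: a b => [[[[] []] []] []] [[[[] []] []] []]. Qed.

Section Coordinates.
Variables (Q : 'rV['F_2]_8 -> 'F_2) (Pi : {vspace 'rV['F_2]_8}).
Hypothesis Q_quadratic : quadratic_form Q.
Hypothesis Q_hyperbolic : hyperbolic Q 4 fullv.
Hypothesis Pi_generator : generator Q Pi.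
Local Notation B := (polar Q).
Local Notation V := 'rV['F_2]_8.

Let Pi_singular : points Pi \subset quadric Q := Pi_generator.2.
Let QPi z : z \in Pi -> Q z = 0 := Pi_quadr0 Q_quadratic Pi_singular (x := z).

Lemma polar_in_Pi x y : x \in Pi -> y \in Pi -> B x y = 0.
Proof. by move=> xPi yPi; rewrite /polar !QPi ?rpredD // !subr0. Qed.

(** The map sending z to the values B z X_j is onto: a linear relation between these forms would
    give a vector of Pi perpendicular to the whole space, which is 0 by nondegeneracy. The rows of a
    left inverse of its matrix M form the family. *)
Lemma dual_family m (X : m.-tuple V) : free X -> {subset X <= Pi} ->
  exists F : 'I_m -> V, forall i j : 'I_m, B (F i) X`_j = (i == j)%:R.
Proof.
move=> freeX XPi.
pose M : 'M['F_2]_(8, m) := \matrix_(k < 8, j < m) B (delta_mx 0 k) X`_j.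
have BM (z : V) (j : 'I_m) : (z *m M) 0 j = B z X`_j.
  rewrite [in RHS](row_sum_delta z) polar_suml // mxE.
  by apply: eq_bigr => k _; rewrite polarZl // mxE.
have : row_full M.
  rewrite /row_full -mxrank_tr -[_ == _]/(row_free M^T); apply: inj_row_free => c cM0.
  pose x := \sum_j c 0 j *: X`_j.
  have xPi : x \in Pi.
    by apply: rpred_sum => j _; rewrite rpredZ // XPi ?mem_nth ?size_tuple.
  have x0 : x = 0.
    have [_ Q_nondegenerate _] := Q_hyperbolic.
    apply: Q_nondegenerate; rewrite ?memvf ?QPi // => y _.
    rewrite polarC /x polar_sumr //.
    transitivity ((c *m M^T *m y^T) 0 0); last by rewrite cM0 mul0mx mxE.
    rewrite -mulmxA -trmx_mul mxE.
    by apply: eq_bigr => j _; rewrite [in RHS]mxE BM polarZr.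
  by apply/rowP=> j; rewrite mxE; rewrite (freeP freeX (fun j => c 0 j) x0).
case/row_fullP=> N NM; exists (fun i => row i N) => i j.
by rewrite -BM -row_mul NM !mxE.
Qed.

(** If v were perpendicular to Pi, then v and Pi would span a totally singular subspace of dimension
    5, against Witt index 4. So some x in Pi has B v x = 1, and a basis of the hyperplane of Pi
    perpendicular to v completes x. *)
Lemma adapted_basis v : v \in G3_vertices Q Pi ->
  exists X : 4.-tuple V,
    [/\ basis_of Pi X & forall j : 'I_4, B v X`_j = (j == 0)%:R].
Proof.
rewrite in_vertices // => /andP[vPi /eqP Qv].
(* [w] represents the form B v, so that the vectors perpendicular to v are the kernel of the linear
   map [f]. *)
pose w : 'M['F_2]_(8, 1) := \matrix_(k, j) B (delta_mx 0 k) v.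
pose f : 'Hom(V, 'M['F_2]_1) := linfun (mulmxr w).
have fE (z : V) : (f z == 0) = (B v z == 0).
  rewrite lfunE /=; suff -> : z *m w = (B v z)%:M.
    by apply/eqP/eqP=> [/matrixP/(_ 0 0)|->]; rewrite ?mxE ?raddf0.
  rewrite [z *m w]mx11_scalar; congr (_%:M).
  rewrite polarC [in RHS](row_sum_delta z) polar_suml // mxE.
  by apply: eq_bigr => k _; rewrite polarZl // mxE.
have [x /andP[xPi vx]] : exists x, (x \in Pi) && (B v x != 0).
  apply/existsP/contraT => /existsPn perp.
  have [_ _ [_ /(_ (<[v]> + Pi)%VS (subvf _))]] := Q_hyperbolic.
  have -> : \dim (<[v]> + Pi) = 5%N.
    rewrite dimv_disjoint_sum ?Pi_generator.1 ?dim_vline.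
      by rewrite (contraNneq _ vPi) // => ->; rewrite mem0v.
    apply/eqP; rewrite -subv0; apply/subvP=> z; rewrite memv_cap mem_vline memv0.
    by case/andP=> /orP[//|/eqP->]; rewrite (negPf vPi).
  case/(_ _)/negP; last by [].
  apply/(points_quadricP Q_quadratic) => z; rewrite mem_addv_line => /orP[/QPi//|vzPi].
  have := perp (v + z); rewrite vzPi negbK polarDr // polarxx // add0r => /eqP vz0.
  by have := QPi vzPi; rewrite quadrD Qv vz0 add0r addr0.
pose K := (Pi :&: lker f)%VS.
have memK z : (z \in K) = (z \in Pi) && (B v z == 0).
  by rewrite memv_cap memv_ker fE.
have bv1 : B v x = 1 by case: (F2_cases (B v x)) vx => ->.
have PiE : (<[x]> + K)%VS = Pi.
  apply/vspaceP=> z; rewrite mem_addv_line !memK.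
  rewrite rpredDl //; case: (z \in Pi) => //=; rewrite polarDr // bv1.
  by case: (F2_cases (B v z)) => ->.
have xK : x \notin K by rewrite memK bv1 andbF.
have dimK : \dim K = 3%N.
  have xK0 : (<[x]> :&: K = 0)%VS.
    apply/eqP; rewrite -subv0; apply/subvP=> z; rewrite memv_cap mem_vline memv0.
    by case/andP=> /orP[//|/eqP->]; rewrite (negPf xK).
  have := dimv_disjoint_sum xK0; rewrite PiE Pi_generator.1 dim_vline.
  have -> : x != 0 by apply: contraNneq xK => ->; rewrite mem0v.
  by rewrite add1n => -[/esym].
have szX : size (x :: vbasis K) == 4%N by rewrite /= size_tuple dimK.
exists (Tuple szX); split.
  rewrite /basis_of /= span_cons (span_basis (vbasisP K)) PiE eqxx /=.
  by rewrite free_cons (span_basis (vbasisP K)) xK (basis_free (vbasisP K)).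
case=> [[|j] lt_j] /=; first by rewrite bv1.
have : (vbasis K)`_j \in K by rewrite vbasis_mem ?mem_nth // size_tuple dimK.
by rewrite memK => /andP[_ /eqP].
Qed.

(** A dual family remains dual when vectors of the totally singular Pi are added to it; this freedom
    makes it totally singular. *)
Lemma hyperbolic_basis v : v \in G3_vertices Q Pi ->
  exists (X : 4.-tuple V) (f : 'I_4 -> V),
    [/\ basis_of Pi X, forall i j : 'I_4, B (f i) X`_j = (i == j)%:R,
        forall i j, B (f i) (f j) = 0, forall i, Q (f i) = 0 & f 0 = v].
Proof.
move=> Vv; have [X [basX vX]] := adapted_basis Vv.
have XPi : {subset X <= Pi} by move=> x; apply: basis_mem.
have ePi (j : 'I_4) : X`_j \in Pi by rewrite XPi ?mem_nth ?size_tuple.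
have [N NX] := dual_family (basis_free basX) XPi.
pose F (i : 'I_4) := if i == 0 then v else N i.
have FX (i j : 'I_4) : B (F i) X`_j = (i == j)%:R.
  by rewrite /F; case: eqP => [->|_]; rewrite ?vX ?NX // eq_sym.
(* Adding [p k] to every [F k] changes Q (F k) by c k k and B (F i) (F j) by c i j + c j i. A
   triangular c therefore corrects each product exactly once. *)
pose c (k j : 'I_4) := if j == k then Q (F k) else if (j < k)%N then B (F k) (F j) else 0.
pose p k := \sum_j c k j *: X`_j.
have pPi k : p k \in Pi by apply: rpred_sum => j _; rewrite rpredZ.
have Fp i k : B (F i) (p k) = c k i.
  rewrite /p polar_sumr // (bigD1 i) //= polarZr // FX eqxx mulr1 big1 ?addr0 //.
  by move=> j; rewrite polarZr // FX eq_sym => /negPf->; rewrite mulr0.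
have F2_addxx (a : 'F_2) : a + a = 0 by case: (F2_cases a) => ->; apply: val_inj.
exists X, (fun k => F k + p k); split=> //.
- by move=> i j; rewrite polarDl // FX polar_in_Pi ?addr0.
- move=> i j; rewrite !(polarDl, polarDr) // (polar_in_Pi (pPi i) (pPi j)) addr0.
  rewrite Fp (polarC Q (p i)) Fp /c (eq_sym i).
  case: (ltngtP i j) => [lt_ij|lt_ji|eq_ij].
  + by rewrite -val_eqE gtn_eqF //= (polarC Q (F j)) addr0 F2_addxx.
  + by rewrite -val_eqE ltn_eqF //= addr0 F2_addxx.
  + by rewrite (val_inj eq_ij) eqxx polarxx // add0r F2_addxx.
- by move=> i; rewrite !quadrD (QPi (pPi i)) Fp /c eqxx addr0 F2_addxx.
(* The vertex v itself is not moved: Q v = 0, and no index is below 0. *)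
have -> : p 0 = 0.
  rewrite /p big1 // => j _; rewrite /c ltn0 /F eqxx.
  by move: Vv; rewrite in_vertices // => /andP[_ /eqP->]; rewrite if_same scale0r.
by rewrite addr0 /F eqxx.
Qed.

Definition half_coord (a : half) (i : 'I_4) : bool :=
  let: (a1, a2, a3, a4) := a in nth false [:: a1; a2; a3; a4] i.

Definition half_comb (g : 'I_4 -> V) (a : half) : V :=
  \sum_i (half_coord a i)%:R *: g i.

Lemma half_combD g : {morph half_comb g : a b / half_add a b >-> a + b}.
Proof.
move=> a b; rewrite -big_split /=; apply: eq_bigr => i _.
rewrite -scalerDl -natr_addb; congr (_%:R *: _).
move: a b i => [[[a1 a2] a3] a4] [[[b1 b2] b3] b4].
by case=> [[|[|[|[|]]]]].
Qed.

Lemma quadr_comb0 g a : (forall i, Q (g i) = 0) ->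
  (forall i j, B (g i) (g j) = 0) -> Q (half_comb g a) = 0.
Proof.
move=> Qg Bg; pose K z := Q z = 0 /\ forall j, B (g j) z = 0.
suff [] : K (half_comb g a) by [].
apply: (big_rec K) => [|i z _ [Qz Bz]].
  by split=> [|j]; rewrite ?(quadr0 Q_quadratic) ?polar0r.
split=> [|j]; last by rewrite polarDr // polarZr // Bg Bz mulr0 addr0.
by rewrite quadrD polarZl // Bz Q_quadratic.1 Qg Qz !mulr0 !addr0.
Qed.

Lemma coordinates v : v \in G3_vertices Q Pi ->
  exists phi : code -> V,
    [/\ injective phi, {morph phi : s t / code_add s t >-> s + t},
        forall t, Q (phi t) = (code_form t)%:R,
        forall t, (phi t \in Pi) = code_pi t & phi code_base = v].
Proof.
case/hyperbolic_basis=> X [f [basX fX ff Qf f0]].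
pose e (i : 'I_4) := X`_i.
have ePi i : e i \in Pi by rewrite (basis_mem basX) ?mem_nth ?size_tuple.
pose phi (t : code) := half_comb e t.1 + half_comb f t.2.
have combPi a : half_comb e a \in Pi by apply: rpred_sum => j _; rewrite rpredZ.
have phiD : {morph phi : s t / code_add s t >-> s + t}.
  by move=> s t; rewrite /phi !half_combD addrACA.
have Bfe a i : B (f i) (half_comb e a) = (half_coord a i)%:R.
  rewrite polar_sumr // (bigD1 i) //= polarZr // fX eqxx mulr1 big1 ?addr0 //.
  by move=> j; rewrite polarZr // fX eq_sym => /negPf->; rewrite mulr0.
have Bfee a i : B (half_comb f a) (e i) = (half_coord a i)%:R.
  rewrite polar_suml // (bigD1 i) //= polarZl // fX eqxx mulr1 big1 ?addr0 //.
  by move=> j; rewrite polarZl // fX => /negPf->; rewrite mulr0.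
have Bff a i : B (f i) (half_comb f a) = 0.
  by rewrite polar_sumr // big1 // => j _; rewrite polarZr // ff mulr0.
have half_ext a : (forall i, (half_coord a i)%:R = 0 :> 'F_2) -> a = half0.
  case: a => [[[a1 a2] a3] a4] a0.
  have := (a0 (inord 0), a0 (inord 1), a0 (inord 2), a0 (inord 3)).
  rewrite /half_coord !inordK //=.
  by case: a1 a2 a3 a4 {a0} => [] [] [] [] [[[]]].
have comb0 g : half_comb g half0 = 0.
  rewrite /half_comb big1 // => i _.
  suff -> : half_coord half0 i = false by rewrite scale0r.
  by case: i => [[|[|[|[|]]]]].
have phiPi t : (phi t \in Pi) = code_pi t.
  rewrite /phi addrC rpredDr // /code_pi; apply/idP/eqP => [tPi|->].
    by apply: half_ext => i; rewrite -Bfee polar_in_Pi.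
  by rewrite comb0 mem0v.
exists phi; split=> //.
(* The sum of s and t is mapped to 0, which lies in Pi, so its second half vanishes; pairing with
   the [f i] then kills its first half. *)
- move=> s t eq_st; have st0 : phi (code_add s t) = 0 by rewrite phiD eq_st addvv.
  have := phiPi (code_add s t); rewrite st0 mem0v => /esym/eqP st2.
  have st1 : half_add s.1 t.1 = half0.
    apply: half_ext => i; rewrite -[half_add _ _]/(code_add s t).1 -Bfe.
    by have := polar0r Q_quadratic (f i); rewrite -st0 polarDr // Bff addr0.
  case: s t st1 st2 {eq_st st0} => [s1 s2] [t1 t2] /=.
  by move=> /eqP; rewrite half_add_eq0 => /eqP-> /eqP; rewrite half_add_eq0 => /eqP->.
- move=> t; rewrite quadrD QPi // quadr_comb0 // !add0r /code_form.
  rewrite {1}/half_comb polar_suml //.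
  under eq_bigr => i _ do rewrite polarZl // polarC Bfee -natr_andb.
  case: t => [[[[a1 a2] a3] a4] [[[b1 b2] b3] b4]].
  by rewrite !big_ord_recl big_ord0 /= addr0 !natr_addb !addrA.
by rewrite /phi comb0 add0r /half_comb !big_ord_recl big_ord0 /= !scale0r !addr0 scale1r.
Qed.

End Coordinates.

(** * Recognizing the kinds in coordinates *)

(** An explicit list, so that [vm_compute] can evaluate computations over all codes. *)
Definition halves : seq half :=
  let bools := [:: false; true] in
  [seq (p, b) | p <- [seq (p, b) | p <- [seq (a, b) | a <- bools, b <- bools],
                                   b <- bools], b <- bools].

Definition codes : seq code := [seq (a, b) | a <- halves, b <- halves].

Lemma mem_codes t : t \in codes.
Proof.
have mem_halves a : a \in halves by move: a => [[[[] []] []] []].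
by move: t => [a b]; apply: allpairs_f.
Qed.

Definition code_vertices : seq code :=
  [seq t <- codes | ~~ code_pi t && ~~ code_form t].

Section Spans.
Variables (phi : code -> 'rV['F_2]_8).
Hypothesis phi_inj : injective phi.
Hypothesis phiD : {morph phi : s t / code_add s t >-> s + t}.
Local Notation V := 'rV['F_2]_8.
Implicit Types (s t u : code) (D : seq code).

(** Doubling only at a generator outside the span so far keeps the list free of repetitions, so that
    its size gives the dimension. *)
Fixpoint code_span D : seq code :=
  if D is c :: D' then
    let U := code_span D' in
    if c \in U then U else U ++ [seq code_add c u | u <- U]
  else [:: code0].

Definition code_image D : {set V} := [set phi t | t in D].

Lemma phi_surj (z : V) : exists t, z = phi t.
Proof.
have phi_bij : bijective phi.
  apply: inj_card_bij => //.
  by rewrite card_mx card_Fp // !card_prod card_bool.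
by case: phi_bij => psi _ psiK; exists (psi z).
Qed.

Lemma code_addK s t : code_add s (code_add s t) = t.
Proof. by apply: phi_inj; rewrite !phiD addrA addvv add0r. Qed.

Lemma phi0 : phi code0 = 0.
Proof.
by apply: (addrI (phi code0)); rewrite -phiD addr0.
Qed.

Lemma phi_eq0 t : (phi t == 0) = (t == code0).
Proof. by rewrite -phi0 (inj_eq phi_inj). Qed.

Lemma mem_code_image D t : (phi t \in code_image D) = (t \in D).
Proof. by rewrite mem_imset. Qed.

Lemma card_code_image D : uniq D -> #|code_image D| = size D.
Proof. by move=> uniqD; rewrite card_imset // -(card_uniqP uniqD). Qed.

Lemma mem_code_span D t : (phi t \in <<map phi D>>%VS) = (t \in code_span D).
Proof.
elim: D t => [|c D IHD] t /=.
  by rewrite span_nil memv0 phi_eq0 inE.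
rewrite span_cons mem_addv_line -phiD !IHD; case: ifP => cU.
  rewrite -!IHD phiD (memv_addr_eq (x := phi c + phi t) (y := phi t)) ?orbb //.
  by rewrite -addrA addvv addr0 IHD.
rewrite mem_cat; congr (_ || _).
apply/idP/mapP => [ctU|[u uU ->]]; last by rewrite code_addK.
by exists (code_add c t); rewrite ?code_addK.
Qed.

Lemma code_span_uniq D : uniq (code_span D).
Proof.
elim: D => //= c D IHD; case: ifP => // cU.
rewrite cat_uniq IHD map_inj_uniq ?IHD ?andbT; last exact: can_inj (code_addK c).
apply/hasPn=> t /mapP[u uU ->]; rewrite -mem_code_span phiD.
by rewrite rpredDr ?mem_code_span ?cU.
Qed.

Lemma size_code_span D : size (code_span D) = (2 ^ \dim <<map phi D>>)%N.
Proof.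
rewrite -(@card_memv _ _ (code_image (code_span D))).
  by rewrite card_code_image ?code_span_uniq.
by move=> z; have [t ->] := phi_surj z; rewrite mem_code_span mem_code_image.
Qed.

Lemma dim_code_span D k : size (code_span D) = (2 ^ k)%N -> \dim <<map phi D>> = k.
Proof. by rewrite size_code_span => /eqP; rewrite eqn_exp2l // => /eqP. Qed.

Definition code_points D :=
  [seq t <- code_span D | (t != code0) && ~~ code_form t].

Definition codes_secant D :=
  all (fun s => all (fun t => (s == t) || code_polar s t) D) D.

(** Pairwise nonperpendicular points bound the Witt index by 1. As B is alternating, the second test
    provides two distinct points, hence index exactly 1 and, by [secant_nondegenerate],
    nondegeneracy. *)
Definition secant_frame D :=
  codes_secant D && has (fun s => has (code_polar s) D) D.

Lemma half_dotC : commutative half_dot.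
Proof.
move=> [[[a1 a2] a3] a4] [[[b1 b2] b3] b4].
by rewrite /half_dot (andbC a1) (andbC a2) (andbC a3) (andbC a4).
Qed.

Lemma code_pi_form t : code_pi t -> code_form t = false.
Proof.
rewrite /code_form => /eqP->; case: t.1 => [[[a1 a2] a3] a4].
by rewrite /= !andbF.
Qed.

Lemma half_dotDl c : {morph (half_dot^~ c) : a b / half_add a b >-> a (+) b}.
Proof.
move=> [[[a1 a2] a3] a4] [[[b1 b2] b3] b4]; case: c => [[[c1 c2] c3] c4] /=.
rewrite !andb_addl (addbACA (a1 && c1)) (addbACA (_ (+) (a2 && c2))).
by rewrite (addbACA (_ (+) (a3 && c3))).
Qed.

Lemma code_formD s t :
  code_form (code_add s t) = code_form s (+) code_form t (+) code_polar s t.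
Proof.
have dotDr a b c : half_dot c (half_add a b) = half_dot c a (+) half_dot c b.
  by rewrite half_dotC half_dotDl !(half_dotC c).
rewrite /code_form /code_polar /= half_dotDl !dotDr (half_dotC s.2 t.1).
by case: (half_dot s.1 s.2) (half_dot s.1 t.2) (half_dot t.1 s.2)
  (half_dot t.1 t.2) => [] [] [] [].
Qed.

Variables (Q : V -> 'F_2) (Pi : {vspace V}).
Hypothesis Q_quadratic : quadratic_form Q.
Hypothesis phiQ : forall t, Q (phi t) = (code_form t)%:R.
Hypothesis phiPi : forall t, (phi t \in Pi) = code_pi t.
Local Notation B := (polar Q).

Lemma phi_polar s t : B (phi s) (phi t) = (code_polar s t)%:R.
Proof.
apply: (addrI (Q (phi s) + Q (phi t))).
by rewrite -quadrD -phiD !phiQ code_formD !natr_addb.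
Qed.

Lemma phi_polar_neq0 s t : (B (phi s) (phi t) != 0) = code_polar s t.
Proof. by rewrite phi_polar natrb_eq0 negbK. Qed.

Lemma phi_quadric t : (phi t \in quadric Q) = (t != code0) && ~~ code_form t.
Proof. by rewrite in_quadric phi_eq0 phiQ natrb_eq0. Qed.

Lemma phi_vertices t :
  (phi t \in G3_vertices Q Pi) = ~~ code_pi t && ~~ code_form t.
Proof. by rewrite in_vertices // phiPi phiQ natrb_eq0. Qed.

Lemma phi_points D t : (phi t \in points <<map phi D>>%VS) =
  (t != code0) && (t \in code_span D).
Proof. by rewrite inE phi_eq0 mem_code_span. Qed.

Lemma points_span_quadric D :
  points <<map phi D>>%VS :&: quadric Q = code_image (code_points D).
Proof.
apply/setP=> z; have [t ->] := phi_surj z.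
rewrite in_setI phi_points phi_quadric mem_code_image mem_filter.
by case: (t == code0); case: (t \in _); rewrite /= ?andbT ?andbF.
Qed.

Lemma codes_secantP D : codes_secant D -> pairwise_secant Q (code_image D).
Proof.
move/allP=> sec x y /imsetP[s sD ->] /imsetP[t tD ->].
rewrite (inj_eq phi_inj) phi_polar_neq0.
by have := allP (sec s sD) t tD; case: eqP.
Qed.

Lemma secant_frameP D : secant_frame (code_points D) ->
  Defs.nondegenerate Q <<map phi D>>%VS /\ witt_index Q <<map phi D>>%VS 1.
Proof.
case/andP=> /codes_secantP sec /hasP[s sD /hasP[t tD st]].
rewrite -points_span_quadric in sec.
have [sD' tD'] : phi s \in points <<map phi D>>%VS :&: quadric Q /\
    phi t \in points <<map phi D>>%VS :&: quadric Q.
  by rewrite points_span_quadric !mem_code_image.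
split; last by apply/witt_index1P => //; split=> //; exists (phi s).
apply: (secant_nondegenerate sec sD' tD').
by apply: (@polar_neq _ Q); rewrite // phi_polar_neq0.
Qed.

Lemma code_span_singular D : all (fun t => ~~ code_form t) (code_span D) ->
  points <<map phi D>>%VS \subset quadric Q.
Proof.
move=> /allP sing; apply/(points_quadricP Q_quadratic) => z.
have [t ->] := phi_surj z; rewrite mem_code_span phiQ => /sing.
by move/negPf=> ->.
Qed.

Definition check_kind1 D := [&& size (code_span D) == 16,
  all (fun t => ~~ code_pi t && (t \in D)) (code_points D),
  all (fun t => t \in code_points D) D & secant_frame (code_points D)].

Lemma check_kind1P D : check_kind1 D -> kind1 Q Pi (code_image D).
Proof.
case/and4P=> /eqP size16 /allP pointsD /allP Dpoints frame.
exists <<map phi D>>%VS.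
have defC : code_image D = points <<map phi D>>%VS :&: quadric Q.
  rewrite points_span_quadric; apply/setP=> z; have [t ->] := phi_surj z.
  rewrite !mem_code_image; apply/idP/idP; first exact: Dpoints.
  by case/pointsD/andP.
split=> //.
  have [nd witt] := secant_frameP frame; split=> //.
  by apply: dim_code_span; rewrite size16.
apply/pred0Pn=> -[z /andP[]] /=; rewrite defC points_span_quadric.
have [t ->] := phi_surj z; rewrite mem_code_image => /pointsD/andP[tPi _].
by rewrite inE phiPi (negPf tPi) andbF.
Qed.

Lemma check_not_kind1 D : (16 < size (code_span D))%N -> ~ kind1 Q Pi (code_image D).
Proof.
move=> lt16 [sigma [[dims _ _] defC _]]; move: lt16; rewrite size_code_span //.
have /dimvS : (<<map phi D>> <= sigma)%VS.
  apply/span_subvP=> z /mapP[t tD ->].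
  by have := mem_code_image D t; rewrite defC tD !inE => /andP[/andP[]].
by rewrite dims ltnNge => le4; rewrite (leq_pexp2l _ le4).
Qed.

Lemma card_generator G (S : {set V}) : generator Q G ->
  (forall z, (z \in G) = (z \in S)) -> #|S| = 16%N.
Proof. by case=> dimG _ GS; rewrite (card_memv GS) dimG. Qed.

(** The form B _ o is linear on G, so it vanishes on G or is nonzero on exactly half of the 16
    vectors. *)
Lemma polar_card8 G o : generator Q G ->
  (8 %| #|[set v in points G | (B v o != 0)%R]|)%N.
Proof.
move=> genG; set A1 := [set v in points G | B v o != 0].
have [->|[g]] := set_0Vmem A1; first by rewrite cards0.
rewrite !inE => /andP[/andP[g0 gG] go].
have F2_neq0 (a : 'F_2) : a != 0 -> a = 1 by case: (F2_cases a) => ->.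
pose A0 := [set v | (v \in G) && (B v o == 0)].
have defA1 : A1 = [set v | (v \in G) && (B v o != 0)].
  apply/setP=> v; rewrite !inE; case: eqVneq => [->|//].
  by rewrite polar0l //= andbF.
have A1A0 : A1 = [set g + v | v in A0].
  apply/setP=> v; rewrite defA1 inE; apply/andP/imsetP => [[vG vo]|[u]].
    exists (g + v); last by rewrite addrA addvv add0r.
    by rewrite inE rpredD // polarDl // (F2_neq0 _ go) (F2_neq0 _ vo).
  rewrite inE => /andP[uG /eqP uo] ->.
  by rewrite rpredD // polarDl // uo addr0.
have card16 : #|A0 :|: A1| = 16%N.
  apply: (card_generator genG) => v.
  by rewrite defA1 !inE -andb_orr orbN andbT.
have : #|A0| = #|A1| by rewrite A1A0 card_imset //; apply: addrI.
move: card16; rewrite cardsU.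
have -> : A0 :&: A1 = set0.
  by apply/setP=> v; rewrite defA1 !inE; case: eqP; rewrite ?andbF.
rewrite cards0 subn0 => card16 eq01; rewrite eq01 in card16.
have -> : #|A1| = 8%N by apply: double_inj; rewrite -addnn card16.
by [].
Qed.

(* If a generator G missed O, double counting the pairs (v, o) in G x O with
   B v o = 1 would give 15 * 4 on one side and a multiple of 8 on the other. *)
Lemma ovoid_intro (O : {set V}) : O \subset quadric Q -> pairwise_secant Q O ->
  {in quadric Q, forall v, v \notin O -> #|[set o in O | B v o != 0]| = 4%N} ->
  ovoid Q O.
Proof.
move=> OQ secO four; split=> // G genG; have [dimG GQ] := genG.
have QG := points_quadricP Q_quadratic G GQ.
have le1 : {in O :&: points G &, forall a b, a = b}.
  move=> a b; rewrite !inE => /and3P[aO a0 aG] /and3P[bO b0 bG].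
  apply/eqP/negPn/negP=> neq_ab; have := secO a b aO bO neq_ab.
  by rewrite /polar !QG ?rpredD // !subr0 eqxx.
have [OG0|[o oOG]] := set_0Vmem (O :&: points G); last first.
  by apply/eqP/cards1P; exists o; apply/setP=> z; rewrite in_set1;
     apply/idP/eqP => [zOG|->//]; apply: le1.
have : (\sum_(v in points G) #|[set o in O | (B v o != 0)%R]| = 60)%N.
  rewrite (eq_bigr (fun _ => 4%N)) => [|v vG].
    rewrite sum_nat_const; have -> : #|points G| = 15%N; last by [].
    have : #|0 |: points G| = 16%N.
      apply: (card_generator genG) => z; rewrite !inE.
      by case: eqVneq => [->|]; rewrite ?mem0v.
    by rewrite cardsU1 !inE eqxx /= => -[].
  apply: four; first exact: (subsetP GQ).
  by apply/negP=> vO; have := in_set0 v; rewrite -OG0 inE vO vG.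
under eq_bigr => v _ do rewrite -sum1_card.
under eq_bigr => v _ do (under eq_bigl => o do rewrite inE); rewrite /=.
rewrite (exchange_big_dep (mem O)) /= => [|v o _ /andP[]//] eq60.
suff : (8 %| 60)%N by [].
rewrite -eq60; apply: dvdn_sum => o oO.
rewrite sum1_card -[X in (8 %| X)%N](_ : #|[set v in points G | B v o != 0]| = _).
  exact: polar_card8.
by apply: eq_card => v; rewrite inE unfold_in oO.
Qed.

(** The ovoid point p in Pi is recovered as the sum of the other eight. The sum of the nine points
    of an ovoid is perpendicular to each of them, because 8 is even, and hence is 0, because they
    span the space. The last test is the hypothesis of [ovoid_intro]. *)
Definition check_kind2 D :=
  let p := foldr code_add code0 D in
  [&& code_pi p, uniq (p :: D), codes_secant (p :: D),
      all (fun t => (t != code0) && ~~ code_form t) (p :: D),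
      all (fun t => ~~ code_pi t) D
    & all (fun t => (t \in p :: D) || (count (code_polar t) (p :: D) == 4))
        [seq t <- codes | (t != code0) && ~~ code_form t]].

Lemma check_kind2P D : check_kind2 D -> kind2 Q Pi (code_image D).
Proof.
rewrite /check_kind2; set p := foldr _ _ _; set O := p :: D.
case/and5P=> pPi uniqO secO /allP OQ /andP[/allP DPi /allP four].
exists (code_image O); split.
  apply: ovoid_intro.
  - by apply/subsetP=> z /imsetP[t tO ->]; rewrite phi_quadric OQ.
  - exact: codes_secantP.
  move=> z zQ; have [t tE] := phi_surj z.
  rewrite tE mem_code_image phi_quadric in zQ * => tO.
  have /four : t \in [seq t <- codes | (t != code0) && ~~ code_form t].
    by rewrite mem_filter zQ mem_codes.
  rewrite (negPf tO) => /eqP; apply: etrans.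
  rewrite -size_filter -card_code_image ?filter_uniq //.
  apply: eq_card => y; have [s ->] := phi_surj y.
  by rewrite inE !mem_code_image mem_filter phi_polar_neq0 andbC.
apply/setP=> z; have [t ->] := phi_surj z.
rewrite in_setD !mem_code_image [_ \in points Pi]inE phi_eq0 phiPi inE.
have [->|neq_tp] /= := eqVneq t p.
  have /andP[p0 _] := OQ p (mem_head _ _).
  by rewrite p0 pPi; apply/negbTE; case/andP: uniqO.
by rewrite andbC; apply/esym/andb_idr => /DPi/negPf->; rewrite andbF.
Qed.

Definition code_misses_Pi D := all (fun t => code_pi t ==> (t == code0)) D.

Definition code_generator D :=
  (size (code_span D) == 16) && all (fun t => ~~ code_form t) (code_span D).

Lemma code_generatorP D : code_generator D -> generator Q <<map phi D>>%VS.
Proof.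
case/andP=> /eqP size16 sing; split; last exact: code_span_singular.
by apply: dim_code_span; rewrite size16.
Qed.

(* A generator meets an ovoid in exactly one point, so its trace on the clique
   has at most one point, and exactly one if it is disjoint from Pi. *)
Definition check_not_kind2 D U :=
  (1 < count (mem U) D)%N || code_misses_Pi U && ~~ has (mem U) D.

Lemma check_not_kind2P D g : uniq D -> code_generator g ->
  check_not_kind2 D (code_span g) -> ~ kind2 Q Pi (code_image D).
Proof.
move=> uniqD /code_generatorP genG meets [O [[OQ one] defC]].
have {one} := one _ genG; case/orP: meets => [two|/andP[missPi /hasPn missD]].
  move=> one; have : (#|code_image [seq t <- D | t \in code_span g]| <= 1)%N.
    apply: leq_trans (eq_leq one); apply/subset_leq_card/subsetP=> z.
    have [t ->] := phi_surj z; rewrite mem_code_image mem_filter => /andP[tg tD].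
    have := mem_code_image D t; rewrite tD defC in_setI => /setDP[tO _].
    rewrite tO phi_points tg andbT -phi_eq0.
    by have := subsetP OQ _ tO; rewrite inE => /andP[].
  by rewrite card_code_image ?filter_uniq // size_filter leqNgt two.
move=> one; have : #|O :&: points <<map phi g>>%VS| != 0%N by rewrite one.
rewrite cards_eq0 => /set0Pn[z]; have [t ->] := phi_surj z.
rewrite in_setI phi_points => /andP[tO /andP[t0 tg]].
have tPi : ~~ code_pi t.
  by have := allP missPi t tg; rewrite implybE (negPf t0) orbF.
have : t \in D by rewrite -mem_code_image defC inE tO inE phiPi (negPf tPi) andbF.
by move/missD; rewrite /= tg.
Qed.

Definition check_kind3 D :=
  [&& code_generator D, all (fun t => code_pi t || (t \in D)) (code_span D),
      all (fun t => ~~ code_pi t) D & count code_pi (code_span D) == 8].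

Lemma mem_code_span_self D t : t \in D -> t \in code_span D.
Proof. by move=> tD; rewrite -mem_code_span memv_span // map_f. Qed.

Lemma check_kind3P D : check_kind3 D -> kind3 Q Pi (code_image D).
Proof.
case/and4P=> /code_generatorP genG /allP UD /allP DPi /eqP count8.
exists <<map phi D>>%VS; split=> //.
  apply/eqP; rewrite -(@eqn_exp2l 2) //.
  rewrite -(@card_memv _ _ (code_image [seq t <- code_span D | code_pi t])).
    by rewrite card_code_image ?filter_uniq ?code_span_uniq // size_filter count8.
  move=> z; have [t ->] := phi_surj z.
  by rewrite memv_cap mem_code_image mem_filter mem_code_span phiPi andbC.
apply/setP=> z; have [t ->] := phi_surj z.
rewrite in_setD phi_points mem_code_image inE phi_eq0 phiPi.
apply/idP/idP=> [tD|/andP[]].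
  rewrite (negPf (DPi t tD)) andbF mem_code_span_self // andbT.
  by apply: contraNneq (DPi t tD) => ->.
by case: (t == code0) => //= tPi /UD; rewrite (negPf tPi).
Qed.

(* A, R and L generate the vertex of the cone, a complement of the vertex, and
   the trace of the cone on Pi. *)
Definition check_cone A R L D :=
  let UA := code_span A in let UR := code_span R in
  let U := code_span (A ++ R) in let UL := code_span L in
  [&& all (fun a => code_pi a && all (fun t => ~~ code_polar a t &&
        ((a != t) || (a == code0))) UR) UA,
      secant_frame (code_points R),
      all (fun t => [|| code_form t, code_pi t | t \in D]) U,
      all (fun t => [&& t \in U, ~~ code_form t & ~~ code_pi t]) D &
      all (fun t => code_form t || (code_pi t == (t \in UL))) U &&
      all (fun t => code_pi t && (t \in U)) UL].

Lemma check_coneP A R L D : check_cone A R L D ->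
  let K := points <<map phi (A ++ R)>>%VS :&: quadric Q in
  [/\ section_is_cone Q <<map phi (A ++ R)>> <<map phi A>> <<map phi R>>,
      (<<map phi L>> <= Pi)%VS, K :&: points Pi = points <<map phi L>>
    & code_image D = K :\: points Pi].
Proof.
case/and5P=> /allP coneA _ /allP UD /allP DU /andP[/allP UL /allP LU] K.
split.
- apply: section_is_cone_intro => //.
  + by rewrite map_cat span_cat.
  + apply/eqP; rewrite -subv0; apply/subvP=> z; rewrite memv_cap memv0.
    have [t ->] := phi_surj z; rewrite !mem_code_span phi_eq0.
    by case/andP=> /coneA/andP[_ /allP coneT] /coneT; rewrite eqxx /= => /andP[].
  + move=> z; have [t ->] := phi_surj z; rewrite mem_code_span => /coneA/andP[tPi _].
    by rewrite phiQ code_pi_form.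
  + move=> y z; have [s ->] := phi_surj y; have [t ->] := phi_surj z.
    rewrite !mem_code_span => /coneA/andP[_ /allP coneT] /coneT/andP[/negPf st _].
    by rewrite phi_polar st.
- apply/subvP=> z; have [t ->] := phi_surj z.
  by rewrite mem_code_span phiPi => /LU/andP[].
- apply/setP=> z; have [t ->] := phi_surj z.
  rewrite in_setI in_setI !phi_points phi_quadric inE phi_eq0 phiPi.
  case: eqP => //= _; apply/idP/idP => [/andP[/andP[tU tQ] tPi]|tL].
    by have := UL t tU; rewrite (negPf tQ) tPi => /eqP<-.
  have /andP[tPi tU] := LU t tL; rewrite tU tPi andbT.
  by rewrite code_pi_form.
apply/setP=> z; have [t ->] := phi_surj z.
rewrite in_setD in_setI phi_points phi_quadric mem_code_image inE phi_eq0 phiPi.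
apply/idP/idP=> [/DU/and3P[tU tQ tPi]|].
  rewrite (negPf tPi) tU tQ !andbT andbF /= andbb.
  by apply: contraNneq tPi => ->.
case: eqP => //= _ /and3P[tPi tU tQ].
by have := UD t tU; rewrite (negPf tPi) (negPf tQ).
Qed.

(** Codes differ by an element of Pi exactly when their second halves agree, so this is [Pi_class]
    in coordinates. *)
Definition fiber D t := [seq s <- D | s.2 == t.2].

(** One point from each coset of Pi that meets D. For kinds 4 and 5 these points span a base of the
    cone. *)
Definition fiber_heads D := [seq t <- D | t == head code0 (fiber D t)].

(** A fiber is {x, x + P}, so its sum is the vertex P. The four heads are points of the base off Pi;
    the five points of an elliptic quadric Q^-(3,2) sum to 0, so the sum of the heads is the fifth
    one, which spans with P the trace on Pi. *)
Definition check_kind4 D :=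
  let P := foldr code_add code0 (fiber D (head code0 D)) in
  let R := fiber_heads D in
  let L := [:: P; foldr code_add code0 R] in
  [&& P != code0, code_pi P, size (code_span R) == 16,
      size (code_span ([:: P] ++ R)) == 32, size (code_span L) == 4
    & check_cone [:: P] R L D].

Lemma check_kind4P D : check_kind4 D -> kind4 Q Pi (code_image D).
Proof.
rewrite /check_kind4; set P := foldr _ _ _; set R := fiber_heads D; set L := [:: P; _].
case/and5P=> P0 PPi /eqP size16 /eqP size32 /andP[/eqP size4 cone].
have [coneD _ KPi defC] := check_coneP cone.
exists <<map phi ([:: P] ++ R)>>%VS, <<map phi R>>%VS, <<map phi L>>%VS, (phi P).
split=> //.
- split; first by apply: dim_code_span; rewrite size32.
  by rewrite inE phi_eq0 P0 phiPi.
- split; last by rewrite -span_seq1.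
  case/and3P: cone => _ /secant_frameP[nd witt] _; split=> //.
  by apply: dim_code_span; rewrite size16.
- by split=> //; apply: dim_code_span; rewrite size4.
Qed.

(** Each of the two planes off l is a coset of l, so the differences within one fiber give l, and
    the two heads are the points of Q^+(1,2). *)
Definition check_kind5 D :=
  let d := head code0 D in
  let L := [seq code_add d t | t <- fiber D d] in
  let R := fiber_heads D in
  [&& size (code_span L) == 4, size (code_span R) == 4,
      size (code_span (L ++ R)) == 16 & check_cone L R L D].

Lemma check_kind5P D : check_kind5 D -> kind5 Q Pi (code_image D).
Proof.
rewrite /check_kind5; set L := [seq _ | _ <- _]; set R := fiber_heads D.
case/and4P=> /eqP sizeL /eqP sizeR /eqP size16 cone.
have [coneD LPi KPi defC] := check_coneP cone.
exists <<map phi (L ++ R)>>%VS, <<map phi R>>%VS, <<map phi L>>%VS.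
split=> //.
- by split; apply: dim_code_span; rewrite ?sizeL ?size16.
- split=> //.
  case/and3P: cone => _ /secant_frameP[nd witt] _; split=> //.
  by apply: dim_code_span; rewrite sizeR.
Qed.

Definition code_type k m D :=
  (size D == k) && all (fun t => size (fiber D t) == m) D.

Lemma code_typeE k m D : uniq D -> class_type Pi k m (code_image D) = code_type k m D.
Proof.
move=> uniqD; rewrite /class_type card_code_image //; congr (_ && _).
have fiberE t : #|Pi_class Pi (code_image D) (phi t)| = size (fiber D t).
  rewrite -card_code_image ?filter_uniq //; apply: eq_card => z.
  have [s ->] := phi_surj z.
  rewrite inE !mem_code_image mem_filter -phiD phiPi andbC; congr (_ && _).
  by rewrite /code_pi half_add_eq0 eq_sym.
apply/forall_inP/allP => [type t tD|type z /imsetP[t tD ->]].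
  by rewrite -fiberE type ?mem_code_image.
by rewrite fiberE type.
Qed.

End Spans.

(** * The maximal cliques through a vertex *)

Definition code_adj (s t : code) : bool :=
  (s != t) && (code_polar s t || (s.2 == t.2)).

Definition code_neighbours : seq code :=
  [seq t <- code_vertices | code_adj code_base t].

Definition code_cliques : seq (seq code) :=
  cliques_from code_adj (size code_neighbours) [:: code_base] code_neighbours [::].

(* The generator {(A y, y)} for the alternating matrix A with upper entries
   a12, a13, a14, a23, a24, a34; it is disjoint from Pi. *)
Definition alternating_graph (a12 a13 a14 a23 a24 a34 : bool) : seq code :=
  [:: ((false, a12, a13, a14), (true, false, false, false));
      ((a12, false, a23, a24), (false, true, false, false));
      ((a13, a23, false, a34), (false, false, true, false));
      ((a14, a24, a34, false), (false, false, false, true))].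

(* The first generator meets every clique of kind 3, 4 or 5 through code_base
   in at least two points; every clique of kind 1 through code_base misses one
   of the other four. *)
Definition code_generators  : seq (seq code) :=
  [:: fiber code_vertices code_base;
      alternating_graph false false true false false false;
      alternating_graph false false true false false true;
      alternating_graph false true false false true false;
      alternating_graph false true false false true true].

Definition code_generator_spans := map code_span code_generators.

(** Besides the certificate for its own kind, a clique of type (8, 1) carries a refutation of kind
    1, and any other clique a refutation of kind 2. *)
Definition check_clique (D : seq code) : bool :=
  if code_type 8 1 D then check_kind2 D && (16 < size (code_span D))%N else
  [|| code_type 5 1 D && check_kind1 D, code_type 8 8 D && check_kind3 D,
      code_type 8 2 D && check_kind4 D | code_type 8 4 D && check_kind5 D] &&
  has (check_not_kind2 D) code_generator_spans.

Lemma check_code_generators : all code_generator code_generators.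
Proof. by vm_compute. Qed.

Lemma check_code_cliques :
  all (fun D => uniq D && check_clique D) code_cliques &&
  ([seq count (code_type km.1 km.2) code_cliques
   | km <- [:: (5, 1); (8, 1); (8, 8); (8, 2); (8, 4)]] ==
   [:: 448; 64; 1; 56; 14]).
Proof. by vm_compute. Qed.

Lemma code_cliques_initial :
  uniq (code_base :: code_neighbours) && all (code_adj code_base) code_neighbours.
Proof. by vm_compute. Qed.

Lemma code_adj_sym : symmetric code_adj.
Proof.
move=> s t; rewrite /code_adj /code_polar eq_sym (eq_sym s.2); congr (_ && (_ || _)).
by rewrite addbC half_dotC (half_dotC s.1).
Qed.

Lemma count_code_cliques (S : {set code}) :
  count_mem S [seq [set x in D] | D <- code_cliques] =
  maxset (is_clique [set t in code_vertices] code_adj) S && (code_base \in S).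
Proof.
have /andP[uniqN /allP adjN] := code_cliques_initial.
rewrite (count_cliques_from code_adj_sym) ?cats0 //.
- rewrite (extends_vertex code_adj_sym (V := [set t in code_vertices])) //.
    by rewrite inE mem_filter mem_codes.
  by move=> w; rewrite /code_neighbours mem_filter [w \in [set _ | _]]inE andbC.
- by apply/pairwise_adjP=> x y; rewrite !inE => /eqP-> /eqP->; rewrite eqxx.
- by move=> c x; rewrite inE => /eqP-> /adjN.
Qed.

(** The existential hides [code_cliques], so that later proofs handle an abstract list and never
    evaluate the enumeration. *)
Lemma code_clique_list : exists L : seq (seq code),
  [/\ forall S : {set code}, count_mem S [seq [set x in D] | D <- L] =
        maxset (is_clique [set t in code_vertices] code_adj) S && (code_base \in S),
      forall D, D \in L -> uniq D && check_clique D
    & [seq count (code_type km.1 km.2) L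
      | km <- [:: (5, 1); (8, 1); (8, 8); (8, 2); (8, 4)]] =
      [:: 448; 64; 1; 56; 14]%N].
Proof.
exists code_cliques; have /andP[/allP checks /eqP counts] := check_code_cliques.
by split; [exact: count_code_cliques | exact: checks | exact: counts].
Qed.

Section Cliques.
Variables (Q : 'rV['F_2]_8 -> 'F_2) (Pi : {vspace 'rV['F_2]_8}).
Hypothesis Q_quadratic : quadratic_form Q.
Hypothesis Q_hyperbolic : hyperbolic Q 4 fullv.
Hypothesis Pi_generator : generator Q Pi.
Local Notation V := 'rV['F_2]_8.
Local Notation maximal := (G3_maximal_clique Q Pi).
Implicit Types (C : {set V}) (v : V).

Let Pi_singular : points Pi \subset quadric Q := Pi_generator.2.

Definition classified C : Prop :=
  [\/ [/\ class_type Pi 5 1 C, kind1 Q Pi C & ~ kind2 Q Pi C],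
      [/\ class_type Pi 8 1 C, kind2 Q Pi C & ~ kind1 Q Pi C],
      [/\ class_type Pi 8 8 C, kind3 Q Pi C & ~ kind2 Q Pi C]
    | [/\ class_type Pi 8 2 C, kind4 Q Pi C & ~ kind2 Q Pi C] \/
      [/\ class_type Pi 8 4 C, kind5 Q Pi C & ~ kind2 Q Pi C]].

Definition count_through v k m :=
  #|[set C | [&& maximal C, class_type Pi k m C & v \in C]]|.

(** The coordinates adapted to v form a graph isomorphism from codes to vectors that sends
    [code_base] to v, and it carries the whole enumeration over. *)
Lemma cliques_through v : v \in G3_vertices Q Pi ->
  (forall C, maximal C -> v \in C -> classified C) /\
  [seq count_through v km.1 km.2
   | km <- [:: (5, 1); (8, 1); (8, 8); (8, 2); (8, 4)]] = [:: 448; 64; 1; 56; 14]%N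
  /\ #|G3_vertices Q Pi| = 120%N.
Proof.
move=> Vv; have [phi [phi_inj phiD phiQ phiPi phi_base]] :=
  coordinates Q_quadratic Q_hyperbolic Pi_generator Vv.
have verticesE t : (phi t \in G3_vertices Q Pi) = (t \in code_vertices).
  by rewrite (phi_vertices phiQ phiPi) mem_filter mem_codes andbT.
have adjE s t : s \in code_vertices -> t \in code_vertices ->
    G3_adj Q Pi (phi s) (phi t) = code_adj s t.
  move=> sV tV; rewrite G3_adj_polar ?verticesE // (inj_eq phi_inj).
  by rewrite (phi_polar_neq0 phiD phiQ) -phiD phiPi /code_pi half_add_eq0.
have cliqueE (S : {set code}) : is_clique (G3_vertices Q Pi) (G3_adj Q Pi) (phi @: S) =
    is_clique [set t in code_vertices] code_adj S.
  rewrite /is_clique; have -> : (phi @: S \subset G3_vertices Q Pi) =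
      (S \subset [set t in code_vertices]).
    apply/subsetP/subsetP=> SV.
      by move=> t tS; rewrite inE -verticesE SV ?imset_f.
    by move=> z /imsetP[t tS ->]; rewrite verticesE; have := SV t tS; rewrite inE.
  case: (boolP (S \subset _)) => //= /subsetP SV.
  have {}SV t : t \in S -> t \in code_vertices by move/SV; rewrite inE.
  apply/forall_inP/forall_inP=> adj.
    move=> s sS; apply/forall_inP=> t tS; rewrite -adjE ?SV // -(inj_eq phi_inj).
    by apply: (forall_inP (adj _ (imset_f _ sS))); apply: imset_f.
  move=> y /imsetP[s sS ->]; apply/forall_inP=> z /imsetP[t tS ->].
  by rewrite adjE ?SV // (inj_eq phi_inj); apply: (forall_inP (adj s sS)).
have preimK (C : {set V}) : phi @: (phi @^-1: C) = C.
  apply/setP=> z; have [t ->] := phi_surj phi_inj z.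
  by rewrite mem_imset // inE.
have maximalE (S : {set code}) : maximal (phi @: S) =
    maxset (is_clique [set t in code_vertices] code_adj) S.
  apply/maxsetP/maxsetP => -[clS max]; split.
  - by rewrite -cliqueE.
  - move=> S' clS' SS'; apply: (imset_inj phi_inj).
    by apply: max; rewrite ?cliqueE ?imsetS.
  - by rewrite cliqueE.
  - move=> C' clC' SC'; rewrite -(preimK C') in clC' *; congr (phi @: _).
    have -> // := max (phi @^-1: C'); first by rewrite -cliqueE.
    by apply/subsetP=> t tS; rewrite inE (subsetP SC') // imset_f.
have [L [count_L check_all counts]] := code_clique_list.
pose cliques := map (code_image phi) L.
have count_cliques C : count_mem C cliques = maximal C && (v \in C).
  rewrite -(preimK C) maximalE -phi_base mem_imset // -count_L.
  rewrite !count_map; apply: eq_count => D /=.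
  rewrite -[code_image phi D](_ : phi @: [set t in D] = _).
    by apply/eqP/eqP=> [/(imset_inj phi_inj)|->].
  by apply/setP=> z; apply/imsetP/imsetP=> -[t]; rewrite ?inE => tD ->;
     exists t; rewrite ?inE.
have mem_cliques C : (C \in cliques) = maximal C && (v \in C).
  by rewrite -has_pred1 has_count count_cliques lt0b.
have uniq_cliques : uniq cliques.
  by apply: count_mem_uniq => C; rewrite count_cliques mem_cliques.
split; last split.
- move=> C maxC vC; have : C \in cliques by rewrite mem_cliques maxC.
  case/mapP=> D /check_all/andP[uniqD]; rewrite /check_clique => checkD ->.
  have typeE k m : class_type Pi k m (code_image phi D) = code_type k m D.
    exact: code_typeE.
  case: ifP checkD => [type81 /andP[kind2D large]|_ /andP[kindD /hasP[U]]].
    apply: Or42; split; rewrite ?typeE //; first exact: check_kind2P.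
    exact: check_not_kind1.
  move=> /mapP[g gen_g ->] meets.
  have not2 : ~ kind2 Q Pi (code_image phi D).
    by apply: check_not_kind2P meets; rewrite // (allP check_code_generators).
  case/or4P: kindD => /andP[typeD kindD].
  + by apply: Or41; split; rewrite ?typeE //; apply: check_kind1P.
  + by apply: Or43; split; rewrite ?typeE //; apply: check_kind3P.
  + by apply: Or44; left; split; rewrite ?typeE //; apply: check_kind4P.
  + by apply: Or44; right; split; rewrite ?typeE //; apply: check_kind5P.
- rewrite -counts; apply: eq_map => -[k m] /=.
  transitivity (size (filter (class_type Pi k m) cliques)).
    rewrite -(card_uniqP (filter_uniq _ uniq_cliques)); apply: eq_card => C.
    by rewrite inE mem_filter mem_cliques andbCA.
  rewrite size_filter count_map; apply: eq_in_count => D /check_all/andP[uniqD _] /=.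
  exact: code_typeE.
have -> : G3_vertices Q Pi = code_image phi code_vertices.
  apply/setP=> z; have [t ->] := phi_surj phi_inj z.
  by rewrite verticesE mem_code_image.
have : uniq code_vertices && (size code_vertices == 120) by vm_compute.
by case/andP=> uniqV /eqP sizeV; rewrite card_code_image.
Qed.

End Cliques.

(** * Counting *)

Section Classification.
Variables (Q : 'rV['F_2]_8 -> 'F_2) (Pi : {vspace 'rV['F_2]_8}).
Hypothesis Q_quadratic : quadratic_form Q.
Hypothesis Q_hyperbolic : hyperbolic Q 4 fullv.
Hypothesis Pi_generator : generator Q Pi.
Local Notation V := 'rV['F_2]_8.
Local Notation maximal := (G3_maximal_clique Q Pi).
Implicit Types (C : {set V}) (v : V).

Let Pi_singular : points Pi \subset quadric Q := Pi_generator.2.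
Let through := cliques_through Q_quadratic Q_hyperbolic Pi_generator.

(** If B F x = 1 with x in Pi, then F is off Pi, since Pi is totally singular, and F + Q F x is
    singular. *)
Lemma exists_vertex : exists v, v \in G3_vertices Q Pi.
Proof.
have [dimPi _] := Pi_generator.
have basX := vbasisP Pi; move: (vbasis Pi) basX; rewrite dimPi => X basX.
have XPi : {subset X <= Pi} by move=> x; apply: basis_mem.
have [F FX] := dual_family Q_quadratic Q_hyperbolic Pi_generator (basis_free basX) XPi.
pose x := X`_(ord0 : 'I_4); have xPi : x \in Pi by rewrite XPi ?mem_nth ?size_tuple.
have Fx : polar Q (F ord0) x = 1 by rewrite FX.
exists (F ord0 + Q (F ord0) *: x); rewrite in_vertices; apply/andP; split.
  rewrite rpredDr ?rpredZ //; apply/negP=> FPi.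
  by have := polar_in_Pi Q_quadratic Pi_generator FPi xPi; rewrite Fx.
rewrite quadrD polarZr // Fx Q_quadratic.1 (Pi_quadr0 Q_quadratic Pi_singular xPi).
by case: (F2_cases (Q (F ord0))) => ->.
Qed.

Lemma maximal_clique_gt0 C : maximal C -> exists x, x \in C.
Proof.
case/maxsetP=> clC max; apply/set0Pn/eqP=> C0.
have [v Vv] := exists_vertex.
have : [set v] = C.
  apply: max; last by rewrite C0 sub0set.
  rewrite /is_clique sub1set Vv; apply/forall_inP=> x; rewrite in_set1 => /eqP->.
  by apply/forall_inP=> y; rewrite in_set1 => /eqP->; rewrite eqxx.
by move/setP/(_ v); rewrite C0 !inE eqxx.
Qed.

Lemma maximal_vertex C x : maximal C -> x \in C -> x \in G3_vertices Q Pi.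
Proof. by case/maxsetP=> clC _; apply: clique_vertex clC. Qed.

Lemma maximal_classified C : maximal C -> classified Q Pi C.
Proof.
move=> maxC; have [x xC] := maximal_clique_gt0 maxC.
by have [] := through (maximal_vertex maxC xC) => /(_ _ maxC xC).
Qed.

Definition of_type k m := [set C | maximal C && class_type Pi k m C].

(* Double counting of the pairs (v, C) with v in C. *)
Lemma card_of_type k m n : (0 < k)%N -> (k %| 120)%N ->
  (forall v, v \in G3_vertices Q Pi -> count_through Q Pi v k m = n) ->
  #|of_type k m| = (120 %/ k * n)%N.
Proof.
move=> k0 dvd_k through_n.
apply/eqP; rewrite -(eqn_pmul2r k0) mulnAC divnK //; apply/eqP.
have [v Vv] := exists_vertex.
have [_ [_ cardV]] := through Vv.
rewrite -cardV -sum_nat_const -[RHS]sum_nat_const.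
transitivity (\sum_(C in of_type k m) \sum_(v in G3_vertices Q Pi | v \in C) 1)%N.
  apply: eq_bigr => C; rewrite inE => /andP[maxC /andP[/eqP <- _]].
  rewrite sum1_card; apply: eq_card => x; rewrite [RHS]unfold_in.
  by rewrite andb_idl //; apply: maximal_vertex.
rewrite (exchange_big_dep (mem (G3_vertices Q Pi))) => [|C x _ /andP[]//] /=.
apply: eq_bigr => x xV; rewrite -(through_n x xV) sum1_card.
apply: eq_card => C; rewrite [LHS]unfold_in xV [C \in of_type _ _]inE [RHS]inE.
by rewrite andTb -andbA.
Qed.

Lemma class_type_uniq k m k' m' C : maximal C ->
  class_type Pi k m C -> class_type Pi k' m' C -> k = k' /\ m = m'.
Proof.
move=> maxC /andP[/eqP <- /forall_inP typem] /andP[/eqP <- /forall_inP typem'].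
have [x xC] := maximal_clique_gt0 maxC.
by rewrite -(eqP (typem x xC)) -(eqP (typem' x xC)).
Qed.

Lemma class_type_other k m k' m' C : maximal C ->
  class_type Pi k m C -> (k, m) != (k', m') -> class_type Pi k' m' C = false.
Proof.
move=> maxC type; apply: contraNF => type'; apply/eqP.
by have [-> ->] := class_type_uniq maxC type type'.
Qed.

Lemma class_type_card k m C x : class_type Pi k m C -> x \in C ->
  #|C| = k /\ #|Pi_class Pi C x| = m.
Proof. by case/andP=> /eqP-> /forall_inP type xC; rewrite (eqP (type x xC)). Qed.

(** Each kind is matched against the five types. The size of the class of one point x rules out most
    pairs; the secant pair separates kind 5 from type (8, 8), and the refutations stored in
    [classified] settle kind 1 against (8, 1) and kind 2 against all other types. *)
Lemma kind_type C : maximal C ->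
  [/\ kind1 Q Pi C <-> class_type Pi 5 1 C, kind2 Q Pi C <-> class_type Pi 8 1 C,
      kind3 Q Pi C <-> class_type Pi 8 8 C
    & (kind4 Q Pi C <-> class_type Pi 8 2 C) /\
      (kind5 Q Pi C <-> class_type Pi 8 4 C)].
Proof.
move=> maxC; have [x xC] := maximal_clique_gt0 maxC.
have k1 : kind1 Q Pi C -> #|Pi_class Pi C x| = 1%N.
  by move=> kindC; rewrite (kind1_class Q_quadratic Pi_singular kindC xC) cards1.
have k3 : kind3 Q Pi C -> #|Pi_class Pi C x| = #|C|.
  by move=> kindC; rewrite (kind3_class Q_quadratic Pi_singular kindC maxC xC).
have k4 : kind4 Q Pi C -> #|Pi_class Pi C x| = 2%N.
  by move=> kindC; apply: (kind4_class Q_quadratic Pi_singular kindC xC).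
have k5 : kind5 Q Pi C -> (3 < #|Pi_class Pi C x|)%N /\ ~~ class_type Pi 8 8 C.
  move=> kindC; split; first exact: kind5_class kindC xC.
  have [y [z [yC zC yz]]] := kind5_secant Q_quadratic kindC.
  apply/negP=> /andP[/eqP card8 /forall_inP/(_ y yC)/eqP classy].
  have : z \in Pi_class Pi C y.
    suff -> : Pi_class Pi C y = C by [].
    apply/eqP; rewrite eqEcard classy card8 leqnn andbT.
    by apply/subsetP=> t; rewrite inE => /andP[].
  rewrite inE zC => yzPi; case/eqP: yz.
  by apply: (polar_Pi Q_quadratic Pi_singular); rewrite ?(maximal_vertex maxC).
case: (maximal_classified maxC) => [[type kind nk]|[type kind nk]|[type kind nk]|
  [[type kind nk]|[type kind nk]]]; have [cardC cardx] := class_type_card type xC;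
  rewrite ?cardC cardx in k1 k3 k4 k5;
  (split; [split | split | split | split; split]) => H;
  first [ exact: type | exact: kind | by move: H; rewrite (class_type_other maxC type)
        | by move/k1: H | by move/k3: H | by move/k4: H | by case: nk
        | by case/k5: H | by case/k5: H; rewrite type ].
Qed.

Definition types : seq (nat * nat) := [:: (5, 1); (8, 1); (8, 8); (8, 2); (8, 4)]%N.

Lemma card_maximal :
  #|[set C | maximal C]| = (\sum_(km <- types) #|of_type km.1 km.2|)%N.
Proof.
rewrite (eq_bigr (fun km => \sum_(C | maximal C) class_type Pi km.1 km.2 C)%N);
  last first.
  move=> km _; rewrite -sum1_card [RHS]big_mkcond [LHS]big_mkcond /=.
  by apply: eq_bigr => C _; rewrite inE; case: (maximal C); case: (class_type _ _ _ _).
rewrite exchange_big /= -sum1_card.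
under eq_bigl => C do rewrite inE.
apply: eq_bigr => C maxC.
rewrite !big_cons big_nil /=.
by case: (maximal_classified maxC) => [[type _ _]|[type _ _]|[type _ _]|
  [[type _ _]|[type _ _]]]; rewrite type !(class_type_other maxC type).
Qed.

(** The first entry stays a product, to be compared with the numeral 10752 by [vm_compute] at the
    end. *)
Lemma cards_of_type :
  [seq #|of_type km.1 km.2| | km <- types] = [:: 24 * 448; 960; 15; 840; 210]%N.
Proof.
have count_n i : (i < 5)%N -> forall v, v \in G3_vertices Q Pi ->
    count_through Q Pi v (nth (0, 0) types i).1 (nth (0, 0) types i).2
    = nth 0 [:: 448; 64; 1; 56; 14]%N i.
  by move=> lti v /through[_ [<- _]]; rewrite (nth_map (0, 0)%N).
rewrite /= (card_of_type _ _ (count_n 0%N _)) // (card_of_type _ _ (count_n 1%N _)) //.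
rewrite (card_of_type _ _ (count_n 2%N _)) // (card_of_type _ _ (count_n 3%N _)) //.
by rewrite (card_of_type _ _ (count_n 4%N _)).
Qed.

Lemma kind_spec_of_type (kind adjacencies : {set V} -> Prop) k m N :
  (forall C, maximal C -> kind C <-> class_type Pi k m C) ->
  (forall C, maximal C -> class_type Pi k m C -> adjacencies C) ->
  #|of_type k m| = N -> kind_spec Q Pi kind N k adjacencies.
Proof.
move=> kindE adj cardN; split.
  exists (of_type k m); split=> // C; rewrite inE.
  by split=> [/andP[maxC /(kindE C maxC)]|[maxC /(kindE C maxC) ->]]; rewrite ?maxC.
move=> C maxC /(kindE C maxC) type; split; last exact: adj.
by case/andP: type => /eqP.
Qed.

End Classification.

Theorem theorem4p14 (Q : 'rV['F_2]_8 -> 'F_2) (Pi : {vspace 'rV['F_2]_8})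
    (Q_quadratic : quadratic_form Q)
    (Q_hyperbolic : hyperbolic Q 4 fullv)
    (Pi_generator : generator Q Pi) :
  #|[set C | G3_maximal_clique Q Pi C]| = 12777 /\
  (forall C, G3_maximal_clique Q Pi C ->
     kind1 Q Pi C \/ kind2 Q Pi C \/ kind3 Q Pi C \/
     kind4 Q Pi C \/ kind5 Q Pi C) /\
  kind_spec Q Pi (kind1 Q Pi) 10752 5 (all_secant Q) /\
  kind_spec Q Pi (kind2 Q Pi) 960 8 (all_secant Q) /\
  kind_spec Q Pi (kind3 Q Pi) 15 8 (all_on_quadric Q Pi) /\
  kind_spec Q Pi (kind4 Q Pi) 840 8 (both_adjacencies Q Pi) /\
  kind_spec Q Pi (kind5 Q Pi) 210 8 (both_adjacencies Q Pi).
Proof.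
have [c1 c2 c3 c4 c5] := cards_of_type Q_quadratic Q_hyperbolic Pi_generator.
have typeP := kind_type Q_quadratic Q_hyperbolic Pi_generator.
have Pi_singular := Pi_generator.2.
have both m C : (1 < m < 8)%N -> G3_maximal_clique Q Pi C -> class_type Pi 8 m C ->
    both_adjacencies Q Pi C.
  move=> m18 maxC type.
  have [x xC] := maximal_clique_gt0 Q_quadratic Q_hyperbolic Pi_generator maxC.
  by case/maxsetP: maxC => clC _; apply: class_type_both type xC m18.
split.
  rewrite (card_maximal Q_quadratic Q_hyperbolic Pi_generator) !big_cons big_nil.
  by rewrite c1 c2 c3 c4 c5; vm_compute.
split=> [C maxC|].
  case: (maximal_classified Q_quadratic Q_hyperbolic Pi_generator maxC) =>
    [[_ kind _]|[_ kind _]|[_ kind _]|[[_ kind _]|[_ kind _]]]; tauto.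
split; last split; last split; last split.
- apply: (kind_spec_of_type (m := 1)) => [C /typeP[]//|C /maxsetP[clC _]|].
    exact: class_type1_secant.
  by rewrite c1; vm_compute.
- apply: (kind_spec_of_type (m := 1)) => [C /typeP[]//|C /maxsetP[clC _]|].
    exact: class_type1_secant.
  by rewrite c2.
- apply: (kind_spec_of_type (m := 8)) => [C /typeP[]//|C /maxsetP[clC _]|].
    exact: class_type_full.
  by rewrite c3.
- apply: (kind_spec_of_type (m := 2)) => [C /typeP[_ _ _ []]//|C|].
    exact: both.
  by rewrite c4.
- apply: (kind_spec_of_type (m := 4)) => [C /typeP[_ _ _ []]//|C|].
    exact: both.
  by rewrite c5.
Qed.
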